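(* Let $(t,w)$ be a semifinite zigzag growth model. For any $\mu\in\mathcal{Z}(t)\setminus J(t)$ and $\lambda\in\mathcal{Z}$ we have $$\varphi_{t,w}(F_\lambda F_\mu)=\varphi_w(F_\lambda)\,\varphi_{t,w}(F_\mu),$$ where $\varphi_w$ is the finite harmonic function on $\mathcal{Z}$ associated with $w$.
   Context: **Zigzag graph.** A binary word is a finite word in the symbols $+,-$; $\sqcup$ is concatenation. A nonempty zigzag $\lambda$ is a composition of a natural number $n=|\lambda|\ge 1$, drawn as a ribbon of $n$ boxes going from top-left to bottom-right. It is encoded by the binary word $\mathsf{bw}(\lambda)$ of length $n-1$ whose $j$-th symbol is $+$ if box $j+1$ is to the right of box $j$ and $-$ if it is below box $j$; this is a bijection between nonempty zigzags and binary words (the one-box zigzag $\square$ corresponds to the empty word). The zigzag graph $\mathcal{Z}$ is the graded graph whose vertices are all nonempty zigzags, graded by $|\lambda|$, together with one vertex $\varnothing$ in level $0$. Edges: $\varnothing\nearrow\square$, and $\lambda\nearrow\mu$ for nonempty $\lambda,\mu$ iff $|\mu|=|\lambda|+1$ and $\mathsf{bw}(\lambda)$ is obtained from $\mathsf{bw}(\mu)$ by deleting one symbol. A function $\varphi:\mathcal{Z}\to\mathbb{R}_{\ge0}\cup\{+\infty\}$ is harmonic if $\varphi(\lambda)=\sum_{\mu:\lambda\nearrow\mu}\varphi(\mu)$ for all $\lambda$. **Quasisymmetric functions.** $\mathit{QSym}$ is the algebra of quasisymmetric functions over $\mathbb{R}$ with the fundamental basis $\{F_\lambda\}_{\lambda\in\mathcal{Z}}$: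 $F_\varnothing=1$ and, for $|\lambda|=n\geq 1$, $F_\lambda=\sum x_{i_1}\cdots x_{i_n}$ over $i_1\le\dots\le i_n$ with $i_j<i_{j+1}$ whenever the $j$-th symbol of $\mathsf{bw}(\lambda)$ is $-$. The structure constants $c_{\lambda\mu}^{\nu}$ in $F_\lambda F_\mu=\sum_\nu c_{\lambda\mu}^\nu F_\nu$ are nonnegative, and $c_{\lambda\mu}^\nu\ne0$ only if $\nu\ge\lambda,\mu$ in the order generated by $\nearrow$. A function $\varphi$ on $\mathcal{Z}$ with values in $\mathbb{R}_{\ge 0}\cup\{+\infty\}$ is applied to nonnegative combinations of the $F_\nu$ by $\varphi\left(\sum c_\nu F_\nu\right)=\sum c_\nu\varphi(\nu)$ (with $0\cdot\infty=0$). **Templates.** A cluster is a symbol $+$ or $-$ with a multiplicity in $\{1,2,\dots\}\cup\{\infty\}$; it is infinite or finite according to its multiplicity. A template is a finite sequence of clusters with alternating signs, at least one of which is infinite. More generally, for a finite sequence $r$ of clusters with signs $s_1,\dots,s_n$ and multiplicities $k_1,\dots,k_n$ (signs not necessarily alternating), $\mathcal{Z}(r)\subset\mathcal{Z}$ consists of $\varnothing$ and all $\lambda$ such that $\mathsf{bw}(\lambda)=s_1^{l_1}\cdots s_n^{l_n}$ for some integers $0\le l_i\le k_i$, $l_i<\infty$. A separating cluster of a template is a finite cluster of multiplicity $1$ which is neither first nor last and whose two neighbours are both infinite. A template is finite if all of its finite clusters are separating, and semifinite otherwise. Let $t$ be a semifinite template. A section of $t$ is a maximal collection of consecutive clusters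 forming a finite template. If $t_1,\dots,t_k$ are the sections from left to right, then $t=(a_0,t_1,a_1,\dots,a_{k-1},t_k,a_k)$, where each $a_i$ is a binary word composed of the consecutive finite non-separating clusters standing there ($a_0,a_k$ may be empty). Put $J(t)=\bigcup_r\mathcal{Z}(r)$, the union over all $r$ obtained from $t$ by decreasing by one the multiplicity of one finite non-separating cluster (deleting the cluster if its multiplicity becomes $0$). For each $\lambda\in\mathcal{Z}(t)\setminus J(t)$ there are unique nonempty zigzags $\lambda^{(i)}\in\mathcal{Z}(t_i)$ with $\mathsf{bw}(\lambda)=a_0\sqcup\mathsf{bw}(\lambda^{(1)})\sqcup a_1\sqcup\dots\sqcup\mathsf{bw}(\lambda^{(k)})\sqcup a_k$. **Growth models.** A semifinite zigzag growth model is a pair $(t,w)$, where $t$ is a semifinite template with $m$ infinite clusters and $w=(w_1,\dots,w_m)$ are positive reals with $w_1+\dots+w_m=1$; $w_j$ is assigned to the $j$-th infinite cluster of $t$ from the left and is given the sign of that cluster as its orientation. Let $v_i$ be the subtuple of $w$ (with orientations) of numbers assigned to infinite clusters of $t_i$. For an ordered tuple $u=(u_1,\dots,u_p)$ of positive reals with orientations in $\{+,-\}$ and a zigzag $\lambda$, put $F_\lambda(u)=\sum u_1^{|\lambda(1)|}\cdots u_p^{|\lambda(p)|}$, the sum over all splittings of the sequence of boxes of $\lambda$ (from top-left to bottom-right) into $p$ consecutive, possibly empty, pieces $\lambda(1),\dots,\lambda(p)$ such that $\lambda(i)$ is a row if $u_i$ is positively oriented and a column if $u_i$ is negatively oriented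 (a single box is both; the empty piece is both). The finite harmonic function $\varphi_w$ on $\mathcal{Z}$ is $\varphi_w(\lambda)=F_\lambda(w)$. The function $\varphi_{t,w}$ is defined by $\varphi_{t,w}(\lambda)=F_{\lambda^{(1)}}(v_1)\cdots F_{\lambda^{(k)}}(v_k)$ for $\lambda\in\mathcal{Z}(t)\setminus J(t)$, $\varphi_{t,w}(\lambda)=+\infty$ for $\lambda\in J(t)$, and it is extended to $\mathcal{Z}$ by $\varphi_{t,w}(\lambda)=0$ for $\lambda\notin\mathcal{Z}(t)$. *)

(* Defs.v *)
From HB Require Import structures.
From mathcomp Require Import all_boot all_order all_algebra.
From mathcomp Require Import finmap multiset.
From mathcomp Require Import boolp classical_sets functions cardinality fsbigop.
From mathcomp Require Import reals constructive_ereal.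

Set Implicit Arguments.
Unset Strict Implicit.
Unset Printing Implicit Defensive.

Import Order.TTheory GRing.Theory Num.Theory.
Local Open Scope classical_set_scope.
Local Open Scope ring_scope.

(* Signs are booleans, with [true] for + and [false] for -. *)
Definition bword := seq bool.

(* [None] is the empty zigzag; [Some w] is the nonempty zigzag whose binary
   word is [w], so that it has [(size w).+1] boxes. *)
Definition zigzag : choiceType := option bword.

Definition zsize (l : zigzag) : nat := if l is Some w then (size w).+1 else 0%N.

Definition zword (l : zigzag) : bword := odflt [::] l.

(* Formal power series in the variables x_0, x_1, ...; the finite multiset [m]
   stands for the monomial in which x_i has exponent [m i]. *)
Definition fps (R : realType) := {mset nat}%mset -> R.

Definition fps_mul (R : realType) (f g : fps R) : fps R := fun m =>
  \sum_(p \in [set p : {mset nat}%mset * {mset nat}%mset | (p.1 `+` p.2)%mset = m])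
    f p.1 * g p.2.

(* The index sequences i_1 <= ... <= i_n of the monomials of F_l. *)
Definition admissible (l : zigzag) (s : seq nat) : Prop :=
  size s = zsize l /\
  forall j, (j < size (zword l))%N ->
    if nth true (zword l) j then (nth 0%N s j <= nth 0%N s j.+1)%N
    else (nth 0%N s j < nth 0%N s j.+1)%N.

Definition fundamental (R : realType) (l : zigzag) : fps R := fun m =>
  \sum_(s \in [set s : seq nat | admissible l s /\ seq_mset s = m]) (1 : R).

Definition fund_comb (R : realType) (c : {fsfun zigzag -> R with 0}) : fps R :=
  fun m => \sum_(n <- finsupp c) c n * fundamental R n m.

(* The coordinates of [f] in the fundamental basis (they are unique); a junk
   value if [f] is not in the span of this basis. *)
Definition fund_coord (R : realType) (f : fps R) :
    {fsfun zigzag -> R with 0} :=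
  xget [fsfun] [set c : {fsfun zigzag -> R with 0} | fund_comb c = f].

(* Linear extension of [phi]; in [\bar R] one has [0 * +oo = 0]. *)
Definition eval_qsym (R : realType) (phi : zigzag -> \bar R) (f : fps R) :
    \bar R :=
  (\sum_(n <- finsupp (fund_coord f)) (fund_coord f n)%:E * phi n)%E.

(* A sign and a multiplicity, [None] being the infinite multiplicity. *)
Definition cluster : eqType := (bool * option nat)%type.

Definition csign (c : cluster) : bool := c.1.
Definition infinite_cluster (c : cluster) : bool := c.2 == None.
Definition finite_cluster (c : cluster) : bool := ~~ infinite_cluster c.

Definition le_mult (l : nat) (k : option nat) : bool :=
  if k is Some k' then (l <= k')%N else true.

(* The set Z(r); [k] lists the lengths l_1, ..., l_n. *)
Definition Zset (r : seq cluster) : set zigzag :=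
  [set l : zigzag | l = None \/
    exists2 k : seq nat, size k = size r &
      (forall i, (i < size r)%N ->
         le_mult (nth 0%N k i) (nth (true, None) r i).2) /\
      l = Some (flatten [seq nseq p.1 (csign p.2) | p <- zip k r])].

Definition template (t : seq cluster) : bool :=
  [&& all (fun c : cluster => c.2 != Some 0%N) t,
      sorted (fun c d => csign c != csign d) t & has infinite_cluster t].

Definition cluster_at (t : seq cluster) (i : nat) : cluster :=
  nth (true, None) t i.

Definition separating (t : seq cluster) (i : nat) : bool :=
  [&& (0 < i)%N, (i.+1 < size t)%N, (cluster_at t i).2 == Some 1%N,
      infinite_cluster (cluster_at t i.-1) &
      infinite_cluster (cluster_at t i.+1)].

Definition nonseparating (t : seq cluster) (i : nat) : bool :=
  [&& (i < size t)%N, finite_cluster (cluster_at t i) & ~~ separating t i].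

Definition finite_template (t : seq cluster) : bool :=
  template t && all (fun i => ~~ nonseparating t i) (iota 0 (size t)).

Definition semifinite_template (t : seq cluster) : bool :=
  template t && ~~ finite_template t.

Definition decrease (t : seq cluster) (i : nat) : seq cluster :=
  let: (s, k) := cluster_at t i in
  take i t ++
  (if k is Some k'.+2 then [:: (s, Some k'.+1)] else [::]) ++
  drop i.+1 t.

(* The set J(t). *)
Definition Jset (t : seq cluster) : set zigzag :=
  [set l | exists2 i, nonseparating t i & Zset (decrease t i) l].

(* A collection of consecutive clusters is a pair [p] of positions: it consists
   of the clusters of index [i] with [p.1 <= i < p.2]. *)
Definition window (T : Type) (s : seq T) (p : nat * nat) : seq T :=
  drop p.1 (take p.2 s).

Definition windows (t : seq cluster) : seq (nat * nat) :=
  [seq p <- [seq (i, j) | i <- iota 0 (size t), j <- iota 0 (size t).+1]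
     | (p.1 < p.2)%N].

Definition is_section (t : seq cluster) (p : nat * nat) : bool :=
  finite_template (window t p) &&
  all (fun q => [&& finite_template (window t q), (q.1 <= p.1)%N
                  & (p.2 <= q.2)%N] ==> (q == p)) (windows t).

(* From left to right, since [windows t] is sorted lexicographically. *)
Definition sections (t : seq cluster) : seq (nat * nat) :=
  [seq p <- windows t | is_section t p].

Definition cluster_word (r : seq cluster) : bword :=
  flatten [seq nseq (odflt 0%N c.2) (csign c) | c <- r].

(* The word a_i, l_(i+1), a_(i+1), ..., l_k, a_k read from position [pos] of
   [t] on, [secs] being the sections of [t] located after [pos]. *)
Fixpoint assemble (t : seq cluster) (pos : nat) (secs : seq (nat * nat))
    (ls : seq bword) : bword :=
  match secs, ls with
  | p :: secs', l :: ls' =>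
      cluster_word (window t (pos, p.1)) ++ l ++ assemble t p.2 secs' ls'
  | _, _ => cluster_word (drop pos t)
  end.

(* [ls] lists the binary words of the nonempty zigzags l^(1), ..., l^(k). *)
Definition decomposition (t : seq cluster) (l : zigzag) (ls : seq bword) :
    Prop :=
  [/\ size ls = size (sections t),
      (forall i, (i < size (sections t))%N ->
         Zset (window t (nth (0%N, 0%N) (sections t) i))
              (Some (nth [::] ls i))) &
      l = Some (assemble t 0 (sections t) ls)].

Definition components (t : seq cluster) (l : zigzag) : seq bword :=
  xget [::] [set ls | decomposition t l ls].

Definition ninf (t : seq cluster) : nat := count infinite_cluster t.

Definition growth_model (R : realType) (t : seq cluster) (w : seq R) : Prop :=
  [/\ semifinite_template t, size w = ninf t, all (fun x => 0 < x) w &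
      \sum_(x <- w) x = 1].

Definition oriented (R : realType) (t : seq cluster) (w : seq R) :
    seq (R * bool) :=
  zip w [seq csign c | c <- t & infinite_cluster c].

(* The subtuple of [w] assigned to the infinite clusters of the window [p]. *)
Definition oriented_window (R : realType) (t : seq cluster) (w : seq R)
    (p : nat * nat) : seq (R * bool) :=
  window (oriented t w) (ninf (take p.1 t), ninf (take p.2 t)).

(* The [n] consecutive boxes of the zigzag with word [w] that follow its first
   [o] boxes form a row ([s = true]) or a column ([s = false]). *)
Definition straight (s : bool) (w : bword) (o n : nat) : bool :=
  all (pred1 s) (take n.-1 (drop o w)).

(* The value F_l(u); a splitting is given by the sizes [k i] of its pieces. *)
Definition fund_at (R : realType) (u : seq (R * bool)) (l : zigzag) : R :=
  \sum_(k : {ffun 'I_(size u) -> 'I_(zsize l).+1} |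
        ((\sum_(i < size u) k i)%N == zsize l) &&
        [forall i : 'I_(size u),
           straight (nth (0, true) u i).2 (zword l)
             (\sum_(j < size u | (j < i)%N) k j)%N (k i)])
    \prod_(i < size u) (nth (0, true) u i).1 ^+ k i.

Definition phi_fin (R : realType) (t : seq cluster) (w : seq R) (l : zigzag) :
    \bar R :=
  (fund_at (oriented t w) l)%:E.

(* On the complement of [Jset t] in [Zset t] the decomposition is unique. *)
Definition phi_semifin (R : realType) (t : seq cluster) (w : seq R)
    (l : zigzag) : \bar R :=
  if l \in Jset t then +oo%E
  else if l \in Zset t then
    (\prod_(p <- zip (components t l) (sections t))
       fund_at (oriented_window t w p.2) (Some p.1))%:E
  else 0%E.

(* Main.v *)
Require Import Defs.
From HB Require Import structures.
From mathcomp Require Import all_boot all_order all_algebra.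
From mathcomp Require Import finmap multiset.
From mathcomp Require Import boolp classical_sets functions cardinality fsbigop.
From mathcomp Require Import reals constructive_ereal.
From mathcomp Require Import zify.

(** The proof describes a zigzag as the pattern of ascents and descents of a
    sequence of distinct letters.  In this model the product of two fundamental
    quasisymmetric functions is the sum of the fundamental functions of the
    shuffles of two sequences with disjoint letters ([fundamental_mul]).  Cutting
    a shuffle into two consecutive parts amounts to cutting both sequences and
    shuffling the parts ([shuffle_sum_conv]); so, writing [conv] for the product
    of functionals obtained by summing over all cuts of a zigzag, [conv]
    preserves multiplicativity, and F_l(u) is multiplicative because it is the
    [conv] of the evaluations at one oriented number, for which this is
    elementary ([shuffle_sum_chis], [fund_atE]).

    Write t = a_0 t_1 a_1 ... t_k a_k, and let a_i' be the zigzag formed by the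
    boxes that lie strictly inside the word a_i: the word a_i without its last
    letter (i = 0), its first letter (i = k) or both; it is empty when a_0 or
    a_k is.  Let Phi be the [conv] of delta_(a_0'), F(v_1), delta_(a_1'), ...,
    F(v_k), delta_(a_k'), where delta_h is the indicator of h.
    Cutting forgets the letters between consecutive pieces, so Phi need not
    vanish on J(t); but a forgotten letter that disagrees with a_i has the sign
    of the adjacent infinite cluster and can be absorbed into it, which leaves a
    proper subword of a_i: the word is then in J(t) ([template_word]).  Off J(t)
    the cut is unique, because moving it to the right would again leave a proper
    subword of some a_i ([block_cut_size]).
    Hence Phi agrees with phi_(t,w) off J(t) ([phi_semifinE]).

    Now apply Phi to F_l F_m with m outside J(t).  By multiplicativity of the
    sections this is a sum over the cuts of l and of m, in which the gap a_i
    contributes the coefficient of F_(a_i') in a product F_x F_y of pieces x of l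
    and y of m.  It vanishes unless y is below a_i', and strictly below when x
    is not empty; in the latter case m would belong to J(t).  So all gap pieces
    of l are empty, and what remains factors as F_l(w) Phi(m)
    ([factor_conv_shuffle_sum]).  Finally J(t) is closed under passing to smaller
    zigzags, so no shuffle lies in J(t) and Phi(F_l F_m) = phi_(t,w)(F_l F_m).
    As [eval_qsym] reads coordinates, it also needs the linear independence of
    the fundamental functions ([fund_comb_inj]). *)

Set Implicit Arguments.
Unset Strict Implicit.
Unset Printing Implicit Defensive.

Import Order.TTheory GRing.Theory Num.Theory.
Local Open Scope ring_scope.

(** * Shuffles *)

Section Shuffle.
Variable T : eqType.
Implicit Types (s t r : seq T).

Fixpoint shuffle s t {struct s} : seq (seq T) :=
  if s is a :: s' then
    (fix shuffle_s t := if t is b :: t' then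
       map (cons a) (shuffle s' t) ++ map (cons b) (shuffle_s t')
     else [:: s]) t
  else [:: t].

Lemma shuffle0s t : shuffle [::] t = [:: t]. Proof. by []. Qed.
Lemma shuffles0 s : shuffle s [::] = [:: s]. Proof. by case: s. Qed.
Lemma shuffle_cons a b s t : shuffle (a :: s) (b :: t) =
  map (cons a) (shuffle s (b :: t)) ++ map (cons b) (shuffle (a :: s) t).
Proof. by []. Qed.

Lemma shuffle_perm s t r : r \in shuffle s t -> perm_eq r (s ++ t).
Proof.
elim: s t r => [|a s IHs] t r; first by rewrite shuffle0s inE => /eqP ->.
elim: t r => [|b t IHt] r; first by rewrite inE => /eqP ->; rewrite cats0.
rewrite shuffle_cons mem_cat => /orP[] /mapP[r' r'P ->].
  by rewrite /= perm_cons IHs.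
rewrite (perm_trans (y := b :: (a :: s) ++ t)) ?perm_cons ?IHt //.
by rewrite perm_sym perm_catC /= perm_cons perm_catC.
Qed.

Lemma shuffle_subseq s t r : r \in shuffle s t -> subseq t r.
Proof.
elim: s t r => [|a s IHs] t r; first by rewrite shuffle0s inE => /eqP ->.
elim: t r => [|b t IHt] r; first by rewrite sub0seq.
rewrite shuffle_cons mem_cat => /orP[] /mapP[r' r'P ->].
  by apply: subseq_trans (IHs _ _ r'P) (subseq_cons _ _).
by rewrite /= eqxx IHt.
Qed.

Lemma shuffle_filter s t r : uniq (s ++ t) -> r \in shuffle s t ->
  [seq x <- r | x \in s] = s /\ [seq x <- r | x \in t] = t.
Proof.
elim: s t r => [|a s IHs] t r.
  rewrite shuffle0s inE => _ /eqP ->; split; first by rewrite filter_pred0.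
  by apply/all_filterP/allP.
elim: t r => [|b t IHt] r U.
  rewrite inE => /eqP ->; split; last by rewrite filter_pred0.
  by apply/all_filterP/allP.
rewrite shuffle_cons mem_cat => /orP[] /mapP[r' r'P ->].
  have /= /andP[aN U'] := U; have [E1 E2] := IHs _ _ U' r'P.
  have ar' : a \notin r' by rewrite (perm_mem (shuffle_perm r'P)).
  rewrite /= mem_head.
  have -> : (a \in b :: t) = false.
    by apply: contraNF aN => ab; rewrite mem_cat ab orbT.
  rewrite E2; split=> //; congr cons; rewrite -[RHS]E1.
  apply: eq_in_filter => x xr; rewrite inE; case: eqP => // xa.
  by rewrite -xa xr in ar'.
have /= /andP[bN U'] : uniq (b :: (a :: s) ++ t).
  by rewrite -cat1s uniq_catCA.
have [E1 E2] := IHt _ U' r'P.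
have br' : b \notin r' by rewrite (perm_mem (shuffle_perm r'P)).
rewrite /= mem_head.
have -> : (b \in a :: s) = false.
  by apply: contraNF bN => ab; rewrite -cat_cons mem_cat ab.
rewrite E1; split=> //; congr cons; rewrite -[RHS]E2.
apply: eq_in_filter => x xr; rewrite inE; case: eqP => // xb.
by rewrite -xb xr in br'.
Qed.

Lemma mem_shuffle_consl c s t r :
  r \in shuffle s t -> c :: r \in shuffle (c :: s) t.
Proof.
case: t => [|b t]; first by rewrite !shuffles0 !inE eqseq_cons eqxx.
by rewrite shuffle_cons mem_cat => rP; rewrite (map_f (cons c)).
Qed.

Lemma mem_shuffle_consr c s t r :
  r \in shuffle s t -> c :: r \in shuffle s (c :: t).
Proof.
case: s => [|a s]; first by rewrite !shuffle0s !inE eqseq_cons eqxx.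
by rewrite shuffle_cons mem_cat orbC => rP; rewrite (map_f (cons c)).
Qed.

(** Splitting a sequence by any predicate exhibits it as a shuffle: this is how
    a sequence is recognized as a shuffle without following the recursion. *)
Lemma mem_shuffle_filter (p : pred T) r :
  r \in shuffle (filter p r) (filter (predC p) r).
Proof.
elim: r => //= c r IHr.
by case: (p c); [apply: mem_shuffle_consl | apply: mem_shuffle_consr].
Qed.

Lemma shuffle_uniq s t : uniq (s ++ t) -> uniq (shuffle s t).
Proof.
elim: s t => [|a s IHs] t //; elim: t => [|b t IHt] // U.
have U1 : uniq ((a :: s) ++ t) by apply: subseq_uniq U; rewrite cat_subseq // subseq_cons.
have U2 : uniq (s ++ b :: t) by case/andP: U.
have inj c : injective (@cons T c) by move=> x y [].
rewrite shuffle_cons cat_uniq !map_inj_uniq // IHs // IHt // andbT andTb.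
apply/hasPn => _ /mapP[r _ ->]; apply/mapP => -[r' _ [ba _]].
by move: U; rewrite ba /= mem_cat mem_head orbT.
Qed.

End Shuffle.

(** * Sums over cuts and sums over shuffles *)

Section Convolution.
Variables (T : eqType) (R : comNzRingType).
Implicit Types (f g : seq T -> R) (s t : seq T).

(** The product of functionals dual to the deconcatenation of sequences. *)
Definition conv f g s : R :=
  \sum_(i < (size s).+1) f (take i s) * g (drop i s).

Definition shuffle_sum f s t : R := \sum_(r <- shuffle s t) f r.

Lemma conv_nil f g : conv f g [::] = f [::] * g [::].
Proof. by rewrite /conv big_ord1. Qed.

Lemma conv_cons f g a s :
  conv f g (a :: s) = f [::] * g (a :: s) + conv (f \o cons a) g s.
Proof. by rewrite /conv big_ord_recl. Qed.

Lemma shuffle_sum0s f t : shuffle_sum f [::] t = f t.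
Proof. by rewrite /shuffle_sum big_seq1. Qed.

Lemma shuffle_sums0 f s : shuffle_sum f s [::] = f s.
Proof. by rewrite /shuffle_sum shuffles0 big_seq1. Qed.

Lemma shuffle_sum_cons f a b s t : shuffle_sum f (a :: s) (b :: t) =
  shuffle_sum (f \o cons a) s (b :: t) + shuffle_sum (f \o cons b) (a :: s) t.
Proof. by rewrite /shuffle_sum shuffle_cons big_cat !big_map. Qed.

Lemma shuffle_sum_conv_cons f g a s t :
  shuffle_sum (conv f g \o cons a) s t =
  f [::] * shuffle_sum (g \o cons a) s t + shuffle_sum (conv (f \o cons a) g) s t.
Proof.
rewrite /shuffle_sum mulr_sumr -big_split /=.
by apply: eq_bigr => r _; rewrite conv_cons.
Qed.

(** Deconcatenation is compatible with shuffles: a prefix of a shuffle of [s] and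
    [t] is a shuffle of a prefix of [s] and a prefix of [t], and what follows is
    a shuffle of the remainders.  The generality in [f] is what makes the
    induction on the first letter go through. *)
Lemma shuffle_sum_conv f g s t : shuffle_sum (conv f g) s t =
  \sum_(i < (size s).+1) \sum_(j < (size t).+1)
    shuffle_sum f (take i s) (take j t) * shuffle_sum g (drop i s) (drop j t).
Proof.
elim: s t f => [|a s IHs] t f.
  rewrite shuffle_sum0s big_ord1 take0 drop0.
  by apply: eq_bigr => j _; rewrite !shuffle_sum0s.
elim: t f => [|b t IHt] f.
  rewrite shuffle_sums0; apply: eq_bigr => i _.
  by rewrite big_ord1 !shuffle_sums0.
rewrite shuffle_sum_cons !shuffle_sum_conv_cons IHs IHt addrACA -mulrDr -shuffle_sum_cons.
rewrite [RHS]big_ord_recl [in RHS]big_ord_recl /= -!addrA shuffle_sum0s; congr (_ + _).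
rewrite [X in _ + X]big_ord_recl /= addrCA; congr (_ + _).
  by apply: eq_bigr => j _; rewrite !shuffle_sum0s.
rewrite -big_split /=; apply: eq_bigr => i _.
rewrite big_ord_recl [in RHS]big_ord_recl /= !shuffle_sums0 -addrA; congr (_ + _).
by rewrite -big_split /=; apply: eq_bigr => j _; rewrite shuffle_sum_cons mulrDl.
Qed.

Lemma convA f g h s : conv f (conv g h) s = conv (conv f g) h s.
Proof.
elim: s f => [|a s IHs] f; first by rewrite !conv_nil mulrA.
have E : conv (conv f g \o cons a) h s =
    f [::] * conv (g \o cons a) h s + conv (conv (f \o cons a) g) h s.
  transitivity (\sum_(i < (size s).+1)
      (f [::] * ((g \o cons a) (take i s) * h (drop i s)) +
       conv (f \o cons a) g (take i s) * h (drop i s))).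
    by apply: eq_bigr => i _; rewrite /= conv_cons mulrDl mulrA.
  by rewrite big_split -mulr_sumr.
by rewrite !conv_cons E conv_nil mulrDr mulrA -addrA IHs.
Qed.

End Convolution.

(** * Zigzags as descent patterns *)

(** Keeping the letter [x] that precedes [s] makes the word of a concatenation the
    concatenation of the words, even when some of the parts are empty. *)
Definition word_from (x : nat) (s : seq nat) : bword :=
  pairmap (fun a b => (a < b)%N) x s.

Definition zigzag_of (s : seq nat) : zigzag :=
  if s is x :: s' then Some (word_from x s') else None.

Definition word (s : seq nat) : bword := zword (zigzag_of s).

Lemma size_word_from x s : size (word_from x s) = size s.
Proof. exact: size_pairmap. Qed.

Lemma zsize_zigzag_of s : zsize (zigzag_of s) = size s.
Proof. by case: s => //= x s; rewrite size_word_from. Qed.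

Lemma word_behead x s : word s = behead (word_from x s).
Proof. by case: s. Qed.

Lemma word_from_cat x s t : word_from x (s ++ t) = word_from x s ++ word_from (last x s) t.
Proof. exact: pairmap_cat. Qed.

Lemma word_cons x s : word (x :: s) = word_from x s. Proof. by []. Qed.

Lemma zigzag_of_word s : s != [::] -> zigzag_of s = Some (word s).
Proof. by case: s. Qed.

Lemma subseq_behead (T : eqType) (u v : seq T) :
  subseq u v -> subseq (behead u) (behead v).
Proof.
case: u v => [|d u] [|c v] //=; first by rewrite sub0seq.
case: eqP => // _ /= /(subseq_trans _); apply; exact: subseq_cons.
Qed.

(** When a letter [b] between [x] and [a] is deleted, the comparisons of [x] with
    [b] and of [b] with [a] are replaced by that of [x] with [a]; by transitivity
    it equals one of the two. *)
Lemma subseq_word_from x s r : subseq s r -> subseq (word_from x s) (word_from x r).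
Proof.
elim: r x s => [|b r IHr] x [|a s] //=; case: eqP => [->|_] sr.
  by rewrite eqxx; apply: IHr.
have /= IH := IHr b _ sr.
case: (eqVneq (x < a)%N (x < b)%N) => [_|ne1].
  by have /= := subseq_trans (subseq_cons _ _) IH.
by have -> : (x < a)%N = (b < a)%N by lia.
Qed.

Lemma subseq_word s r : subseq s r -> subseq (word s) (word r).
Proof.
by move=> sr; rewrite !(word_behead 0); apply/subseq_behead/subseq_word_from.
Qed.

Lemma zigzag_of_addn N s : zigzag_of (map (addn N) s) = zigzag_of s.
Proof.
case: s => //= x s; congr Some; elim: s x => //= y s IHs x.
by rewrite ltn_add2l IHs.
Qed.

(** A letter in front of a sequence is made an ascent by shifting the sequence up
    and putting 0, and a descent by putting a new maximum. *)
Lemma zigzag_of_surj l : exists2 s, uniq s & zigzag_of s = l.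
Proof.
case: l => [w|]; last by exists [::].
elim: w => [|b w [s Us zs]]; first by exists [:: 0%N].
case: s => [|x s] // in Us zs *; case: zs => zs.
case: b.
  exists (0%N :: map (addn 1) (x :: s)); last first.
    by rewrite /= -zs; have [<-] := zigzag_of_addn 1 (x :: s).
  rewrite cons_uniq (map_inj_uniq (@addnI 1%N)) Us andbT.
  by apply/mapP => -[].
pose M := (\max_(y <- x :: s) y).+1.
have ltM y : y \in x :: s -> (y < M)%N by move=> yP; rewrite ltnS leq_bigmax_seq.
exists (M :: x :: s); last first.
  by rewrite /= zs ltnNge ltnW // ltM // mem_head.
by rewrite cons_uniq Us andbT; apply/negP => /ltM; rewrite ltnn.
Qed.

Lemma zigzag_of_surj2 l m : exists s t, [/\ uniq (s ++ t), zigzag_of s = l & zigzag_of t = m].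
Proof.
have [s Us sl] := zigzag_of_surj l; have [t Ut tm] := zigzag_of_surj m.
pose M := (\max_(y <- s) y).+1.
exists s, (map (addn M) t); split; rewrite ?zigzag_of_addn //.
rewrite cat_uniq Us (map_inj_uniq (@addnI M)) Ut andbT.
apply/hasPn => _ /mapP[y _ ->]; apply/negP => Ms.
have : (M + y <= \max_(z <- s) z)%N by apply: (@leq_bigmax_seq _ _ xpredT id).
rewrite /M; lia.
Qed.

(** * Multiplicative functionals given by oriented numbers *)

(** The only candidate for a sorted shuffle is the sorted arrangement of all
    letters, and it is a shuffle exactly when both sequences are sorted. *)
Lemma count_sorted_shuffle (T : eqType) (e : rel T) (s t : seq T) :
    transitive e -> {in s & t, forall a b, e a b = ~~ e b a} ->
  count (sorted e) (shuffle s t) = (sorted e s && sorted e t).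
Proof.
move=> tr; elim: s t => [|a s IHs] t; first by rewrite shuffle0s /= addn0.
elim: t => [|b t IHt] et; first by rewrite shuffles0 andbT /= addn0.
have cnt (c : T) (s1 t1 : seq T) : count (sorted e) (map (cons c) (shuffle s1 t1)) =
    (all (e c) s1 && all (e c) t1 * count (sorted e) (shuffle s1 t1))%N.
  rewrite count_map -all_cat.
  rewrite (eq_in_count (a2 := fun r => all (e c) (s1 ++ t1) && sorted e r)).
    by case: all; rewrite /= ?mul1n // mul0n count_pred0.
  by move=> r rP /=; rewrite path_sortedE // (perm_all _ (shuffle_perm rP)).
rewrite shuffle_cons count_cat !cnt IHs ?IHt; first last.
- by move=> x y xs yt; apply: et => //; rewrite inE xs orbT.
- by move=> x y xs yt; apply: et => //; rewrite inE yt orbT.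
have eab := et a b (mem_head _ _) (mem_head _ _).
have ->: sorted e (a :: s) = all (e a) s && sorted e s by rewrite /= path_sortedE.
have ->: sorted e (b :: t) = all (e b) t && sorted e t by rewrite /= path_sortedE.
have all_trans c d l : e c d -> all (e d) l -> all (e c) l.
  by move=> cd /allP dl; apply/allP => y /dl; apply: tr.
rewrite /= eab; have [ba|nba] := boolP (e b a) => /=.
  move: (all_trans b a s ba); move: (all (e a) s) (all (e b) s) (all (e b) t).
  by move=> [] [] [] H //; case: (sorted e s) (sorted e t) => [] [] //; case: (H isT).
move: (all_trans a b t); rewrite eab nba => /(_ isT).
move: (all (e a) s) (all (e a) t) (all (e b) t).
by move=> [] [] [] H //; case: (sorted e s) (sorted e t) => [] [] //; case: (H isT).
Qed.

Section Characters.
Variable R : comNzRingType.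
Implicit Types (u : R * bool) (v : seq (R * bool)) (s t r : seq nat).

(** The neutral functional of [conv]. *)
Definition counit s : R := (s == [::])%:R.
(** F at the single oriented number [u]: rows only if [u] is positive, columns only
    if it is negative. *)
Definition chi u s : R := if all (pred1 u.2) (word s) then u.1 ^+ size s else 0.
Definition chis v : seq nat -> R := foldr (fun u f => conv (chi u) f) counit v.
Definition delta (h : zigzag) s : R := (zigzag_of s == h)%:R.

Lemma eq_conv (T : eqType) (f f' g g' : seq T -> R) :
  f =1 f' -> g =1 g' -> conv f g =1 conv f' g'.
Proof. by move=> ff gg s; apply: eq_bigr => i _; rewrite ff gg. Qed.

Lemma conv_counit (g : seq nat -> R) s : conv counit g s = g s.
Proof.
rewrite /conv big_ord_recl take0 drop0 /counit eqxx mul1r big1 ?addr0 // => i _.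
by case: s i => [[]|a s i] //=; rewrite mul0r.
Qed.

Lemma chis_cat v1 v2 : chis (v1 ++ v2) =1 conv (chis v1) (chis v2).
Proof.
elim: v1 => [|u v1 IH] s /=; first by rewrite conv_counit.
by rewrite (eq_conv (fun=> erefl) IH) convA.
Qed.

Lemma shuffle_sum_counit s t : shuffle_sum counit s t = counit s * counit t.
Proof.
case: s => [|a s]; first by rewrite shuffle_sum0s /counit eqxx mul1r.
case: t => [|b t]; first by rewrite shuffle_sums0 /counit eqxx mulr1.
rewrite /shuffle_sum big1_seq /counit /= ?mul0r // => r.
by case: r => //; rewrite mem_cat => /orP[]/mapP[].
Qed.

(** A row is an increasing sequence of letters and a column a decreasing one; for
    [b = false] the relation is [>=], which is [>] on distinct letters. *)
Definition ascends (b : bool) : rel nat := fun x y => (x < y)%N == b.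

Lemma ascends_trans b : transitive (ascends b).
Proof. by rewrite /ascends => y x z; case: b; lia. Qed.

Lemma all_word b s : all (pred1 b) (word s) = sorted (ascends b) s.
Proof. by case: s => //= x s; elim: s x => //= y s IHs x; rewrite IHs. Qed.

Lemma shuffle_sum_chi u s t : uniq (s ++ t) -> shuffle_sum (chi u) s t = chi u s * chi u t.
Proof.
move=> U; transitivity (\sum_(r <- shuffle s t)
    (sorted (ascends u.2) r)%:R * u.1 ^+ (size s + size t)).
  apply: eq_big_seq => r /shuffle_perm /perm_size.
  rewrite size_cat /chi all_word => ->.
  by case: sorted; rewrite ?mul1r ?mul0r.
rewrite -mulr_suml -natr_sum -big_mkcond /= sum1_count count_sorted_shuffle.
- rewrite /chi !all_word; do 2!case: sorted; rewrite ?mul1r ?mul0r ?mulr0 //.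
  by rewrite exprD.
- exact: ascends_trans.
move=> a b sa tb; rewrite /ascends; suff: a != b by case: (u.2); lia.
apply: contraTneq U => ab; rewrite cat_uniq negb_and; apply/orP; right.
by rewrite negb_and; apply/orP; left; rewrite negbK; apply/hasP; exists b; rewrite // -ab.
Qed.

(** The functional F(v) is multiplicative, since [conv] preserves
    multiplicativity. *)
Lemma shuffle_sum_chis v s t : uniq (s ++ t) ->
  shuffle_sum (chis v) s t = chis v s * chis v t.
Proof.
elim: v s t => [|u v IHv] s t U /=; first exact: shuffle_sum_counit.
rewrite shuffle_sum_conv mulr_suml; apply: eq_bigr => i _.
rewrite mulr_sumr; apply: eq_bigr => j _.
have U1 : uniq (take i s ++ take j t).
  by apply: subseq_uniq U; apply: cat_subseq; apply: take_subseq.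
have U2 : uniq (drop i s ++ drop j t).
  by apply: subseq_uniq U; apply: cat_subseq; apply: drop_subseq.
by rewrite (shuffle_sum_chi _ U1) (IHv _ _ U2); apply: mulrACA.
Qed.

End Characters.

(** * The values F_l(u) as sums over cuts *)

Lemma word_take n s : word (take n s) = take n.-1 (word s).
Proof.
case: s => [|x s]; first by case: n => [|[|n]].
case: n => [|n]; rewrite ?take0 // /word /= /word_from.
by elim: n x s => [|n IHn] x [|y s] //=; rewrite IHn.
Qed.

Lemma word_drop n s : word (drop n s) = drop n (word s).
Proof.
case: s => // x s; elim: n x s => [|n IHn] x [|y s] //.
by rewrite [drop _ _]/= IHn.
Qed.

Section FundAt.
Variable R : realType.
Implicit Types (u : seq (R * bool)) (s : seq nat).

Lemma sum_ffun_recl (A : finType) p (P : pred {ffun 'I_p.+1 -> A})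
    (F : {ffun 'I_p.+1 -> A} -> R) :
  let ext (a : A) (f : {ffun 'I_p -> A}) : {ffun 'I_p.+1 -> A} :=
    [ffun i => if unlift ord0 i is Some j then f j else a] in
  \sum_(k | P k) F k = \sum_a \sum_(f | P (ext a f)) F (ext a f).
Proof.
move=> ext; rewrite pair_big_dep /=.
rewrite (reindex (fun q : A * {ffun 'I_p -> A} => ext q.1 q.2)) //.
apply: onW_bij; exists (fun k : {ffun 'I_p.+1 -> A} => (k ord0, [ffun j => k (lift ord0 j)])).
  move=> [a f] /=; rewrite /ext ffunE unlift_none; congr pair.
  by apply/ffunP => j; rewrite !ffunE liftK.
move=> k; apply/ffunP => i; rewrite /ext !ffunE.
by case: unliftP => [j ->|->] //; rewrite ffunE.
Qed.

(** The bound [N] on the sizes of the pieces is independent of [s], so that the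
    induction can pass from [s] to what remains after the first piece. *)
Lemma chisE u s N : (size s <= N)%N ->
  \sum_(k : {ffun 'I_(size u) -> 'I_N.+1} | (\sum_(i < size u) k i)%N == size s)
    \prod_(i < size u) chi (nth (0, true) u i)
      (take (k i) (drop (\sum_(j < size u | (j < i)%N) k j) s)) = chis u s.
Proof.
elim: u s => [|u0 u IHu] s sN.
  rewrite /= /counit big_mkcond (big_pred1 [ffun i => ord0]) /=.
    by rewrite !big_ord0 eq_sym size_eq0; case: eqP.
  by move=> k; apply/esym/eqP/ffunP => -[].
rewrite (@sum_ffun_recl _ (size u)) [chis _ _]/= /conv.
rewrite (big_ord_widen_cond N.+1 xpredT
  (fun i => chi u0 (take i s) * chis u (drop i s))) // [RHS]big_mkcond.
apply: eq_bigr => a _; rewrite ltnS.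
have sumE (f : {ffun 'I_(size u) -> 'I_N.+1}) (Q : pred nat) : Q 0%N ->
   (\sum_(i < (size u).+1 | Q i)
     [ffun i0 => if unlift ord0 i0 is Some j then f j else a] i =
   a + \sum_(i < size u | Q i.+1) f i)%N.
  move=> Q0; rewrite big_mkcond big_ord_recl Q0 ffunE unlift_none /=; congr addn.
  by rewrite [RHS]big_mkcond; apply: eq_bigr => i _; rewrite ffunE liftK.
case: leqP => [as_|sa]; last first.
  rewrite big_pred0 // => f; rewrite (sumE f xpredT) //. 
  by rewrite gtn_eqF // (leq_trans sa) // leq_addr.
have ds : (size (drop a s) <= N)%N by rewrite size_drop; lia.
rewrite -(IHu _ ds) mulr_sumr; apply: eq_big => [f|f _].
  by rewrite (sumE f xpredT) // size_drop -{1}(subnKC as_) eqn_add2l.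
rewrite [LHS]big_ord_recl; congr (_ * _).
  by rewrite big_pred0 // drop0 ffunE unlift_none.
apply: eq_bigr => i _; rewrite (sumE f (fun j => j < bump 0 i)%N) //.
by rewrite ffunE liftK drop_drop (addnC (\sum_(j < size u | (j < i)%N) f j)%N).
Qed.

Lemma fund_atE u s : fund_at u (zigzag_of s) = chis u s.
Proof.
rewrite -(chisE u (leqnn (size s))) /fund_at zsize_zigzag_of.
rewrite big_mkcondr /=; apply: eq_bigr => k /eqP sk.
have pieceE (i : 'I_(size u)) :
    size (take (k i) (drop (\sum_(j < size u | (j < i)%N) k j) s)) = k i.
  rewrite size_takel // size_drop.
  apply: (@leq_trans (\sum_(j < size u) k j - \sum_(j < size u | (j < i)%N) k j)).
    rewrite (bigID (fun j : 'I_(size u) => (j < i)%N)) /= addKn (bigD1 i) ?ltnn //=.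
    exact: leq_addr.
  by rewrite sk.
have stE (i : 'I_(size u)) : straight (nth (0, true) u i).2 (zword (zigzag_of s))
     (\sum_(j < size u | (j < i)%N) k j) (k i) =
   all (pred1 (nth (0, true) u i).2)
     (word (take (k i) (drop (\sum_(j < size u | (j < i)%N) k j) s))).
  by rewrite /straight word_take word_drop.
case: forallP => [st|/forallP]; last first.
  rewrite negb_forall => /existsP[i]; rewrite stE => nst.
  by rewrite (bigD1 i) //= /chi (negbTE nst) mul0r.
by apply: eq_bigr => i _; rewrite /chi -stE st pieceE.
Qed.

End FundAt.

(** * Products of fundamental quasisymmetric functions *)

Definition lexlt : rel (nat * nat) := fun p q =>
  (p.1 < q.1)%N || (p.1 == q.1) && (p.2 < q.2)%N.

(** Labelling the letters of [s] by the indices [I], the condition on the index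
    sequence of a monomial says that the labelled letters increase
    lexicographically.  In this form it restricts to subsequences and merges
    along shuffles. *)
Definition compat (I s : seq nat) : bool :=
  (size I == size s) && sorted lexlt (zip I s).

Lemma lexlt_trans : transitive lexlt.
Proof. by move=> [b1 b2] [a1 a2] [c1 c2]; rewrite /lexlt /=; lia. Qed.

Lemma lexlt_irr : irreflexive lexlt.
Proof. by move=> [a1 a2]; rewrite /lexlt /= eqxx !ltnn. Qed.

Lemma admissibleP I s : admissible (zigzag_of s) I <-> compat I s.
Proof.
rewrite /admissible /compat zsize_zigzag_of.
have wE j : (j.+1 < size s)%N ->
    nth true (word s) j = (nth 0%N s j < nth 0%N s j.+1)%N.
  by case: s => // x s js; rewrite word_cons (nth_pairmap 0%N).
have sw : size (zword (zigzag_of s)) = (size s).-1.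
  by case: s {wE} => //= x s; rewrite size_word_from.
split=> [[sI H]|/andP[/eqP sI /(sortedP (0%N, 0%N)) H]].
  rewrite sI eqxx; apply/(sortedP (0%N, 0%N)) => j.
  rewrite size1_zip ?sI // => js; have := H j; rewrite wE // sw !nth_zip //.
  by rewrite /lexlt /=; case: ifP; lia.
split=> // j; rewrite sw => js; have := H j.
rewrite size1_zip ?sI // !nth_zip // wE; last by lia.
by rewrite /lexlt /=; case: ifP; lia.
Qed.

Lemma compat_sorted I s : compat I s -> sorted leq I.
Proof.
case/andP => /eqP sI; rewrite -{2}(unzip1_zip (s := I) (t := s)) ?sI //.
rewrite sorted_map; apply: sub_sorted => p q.
by rewrite /lexlt /=; lia.
Qed.

Section FundamentalProduct.
Variable R : realType.
Implicit Types (s t r I : seq nat) (m : {mset nat}%mset).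

Definition msort m : seq nat := sort leq m.

Lemma msort_seq_mset I : sorted leq I -> msort (seq_mset I) = I.
Proof.
move=> sI; apply: (sorted_eq leq_trans anti_leq) => //.
  exact: (sort_sorted leq_total).
by rewrite (perm_trans _ (perm_eq_seq_mset I)) // perm_sort.
Qed.

Lemma seq_mset_msort m : seq_mset (msort m) = m.
Proof. by rewrite -[RHS]seq_mset_id; apply/eq_seq_msetP; rewrite perm_sort. Qed.

Lemma fundamentalE s m : fundamental R (zigzag_of s) m = (compat (msort m) s)%:R.
Proof.
rewrite /fundamental; have [cm|ncm] := boolP (compat _ _).
  rewrite (_ : [set _ | _]%classic = [set msort m]%classic) ?fsbig_set1 //.
  apply/seteqP; split=> [I /= [/admissibleP cI <-]|_ ->] /=.
    by rewrite msort_seq_mset // (compat_sorted cI).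
  by rewrite seq_mset_msort; split=> //; apply/admissibleP.
rewrite (_ : [set _ | _]%classic = set0) ?fsbig_set0 //.
apply/seteqP; split=> [I /= [/admissibleP cI Im]|//].
by move: ncm; rewrite -Im msort_seq_mset ?cI // (compat_sorted cI).
Qed.

Definition subindex (s I r : seq nat) : seq nat :=
  unzip1 [seq p <- zip I r | p.2 \in s].

Lemma zip_subindex s I r : size I = size r -> [seq x <- r | x \in s] = s ->
  zip (subindex s I r) s = [seq p <- zip I r | p.2 \in s].
Proof.
move=> sI rs; rewrite -{2}rs -{2}(unzip2_zip (s := I) (t := r)) ?sI //.
by rewrite /unzip2 filter_map /subindex zip_unzip.
Qed.

Lemma compat_subindex s I r : [seq x <- r | x \in s] = s ->
  compat I r -> compat (subindex s I r) s.
Proof.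
move=> rs /andP[/eqP sI so]; rewrite /compat zip_subindex //.
rewrite (sorted_filter lexlt_trans) // andbT -{2}rs.
rewrite -{2}(unzip2_zip (s := I) (t := r)) ?sI // /unzip2 filter_map !size_map.
exact/eqP.
Qed.

(** A monomial of F_s F_t is given by an index labelling of [s] and one of [t]; the
    lexicographic sort of all labelled letters is a shuffle of [s] and [t] with
    its labels, and the two labellings are recovered by restriction.  The
    identity follows, as the coefficients of the fundamental functions are 0 or 1. *)
Lemma fundamental_mul s t : uniq (s ++ t) ->
  fps_mul (fundamental R (zigzag_of s)) (fundamental R (zigzag_of t)) =
  fun m => \sum_(r <- shuffle s t) fundamental R (zigzag_of r) m.
Proof.
move=> U; apply/funext => m; rewrite /fps_mul.
set I := msort m.
pose G r := (seq_mset (subindex s I r), seq_mset (subindex t I r)).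
(* The shuffles that contribute to the coefficient of the monomial [m]; [G] sends
   such a shuffle to a pair of monomials with product [m]. *)
pose rs := [seq r <- shuffle s t | compat I r].
have fil r : r \in rs -> [/\ compat I r, [seq x <- r | x \in s] = s,
    [seq x <- r | x \in t] = t & perm_eq r (s ++ t)].
  rewrite mem_filter => /andP[cr rP]; have [] := shuffle_filter U rP.
  by split=> //; apply: shuffle_perm rP.
have part r : r \in rs -> perm_eq (zip I r)
    (zip (subindex s I r) s ++ zip (subindex t I r) t).
  move=> rP; have [/andP[/eqP sI _] fs ft pr] := fil r rP.
  rewrite !zip_subindex //.
  rewrite (_ : [seq p <- zip I r | p.2 \in t] =
     [seq p <- zip I r | predC (fun p => p.2 \in s) p]).
    by rewrite perm_sym; apply/permPl/perm_filterC.
  apply: eq_in_filter => -[i x] /= /(map_f snd) /=; rewrite -/(unzip2 _).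
  rewrite unzip2_zip ?sI // (perm_mem pr) mem_cat => xst.
  move: U; rewrite cat_uniq => /and3P[_ /hasPn H _].
  by case: (boolP (x \in t)) xst => [/H /= /negbTE -> //|_]; rewrite orbF => ->.
have subE r (u : seq nat) : [seq x <- r | x \in u] = u -> compat I r ->
    msort (seq_mset (subindex u I r)) = subindex u I r.
  by move=> fu /(compat_subindex fu) /compat_sorted; apply: msort_seq_mset.
have addE I1 I2 : (seq_mset I1 `+` seq_mset I2)%mset = seq_mset (I1 ++ I2).
  by apply/msetP => x; rewrite msetE2 !mset_seqE count_cat.
have rsU : uniq (map G rs).
  rewrite map_inj_in_uniq ?filter_uniq ?shuffle_uniq // => r1 r2 r1P r2P [E1 E2].
  have [c1 fs1 ft1 pr1] := fil r1 r1P; have [c2 fs2 ft2 pr2] := fil r2 r2P.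
  have := part r1 r1P; rewrite -(subE _ _ fs1 c1) E1 -(subE _ _ ft1 c1) E2.
  rewrite !subE // => p12; have := part r2 r2P.
  rewrite perm_sym => /(perm_trans p12) {}p12.
  have /andP[/eqP s1 o1] := c1; have /andP[/eqP s2 o2] := c2.
  rewrite -(unzip2_zip (s := I) (t := r1)) ?s1 //.
  rewrite (irr_sorted_eq lexlt_trans lexlt_irr o1 o2 (perm_mem p12)).
  by rewrite unzip2_zip ?s2.
have rsA : ([set` map G rs] `<=` [set p | p.1 `+` p.2 = m]%mset)%classic.
  move=> _ /= /mapP[r rP ->] /=; rewrite addE -[RHS]seq_mset_msort.
  have [/andP[/eqP sI _] fs ft _] := fil r rP.
  apply/eq_seq_msetP; have := part r rP => /(perm_map fst).
  rewrite map_cat -/(unzip1 _) unzip1_zip ?sI // perm_sym.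
  have szs (u : seq nat) : [seq x <- r | x \in u] = u -> (size (subindex u I r) <= size u)%N.
    move=> fu; rewrite -{2}fu -{2}(unzip2_zip (s := I) (t := r)) ?sI //.
    by rewrite /unzip2 filter_map !size_map.
  by rewrite -/(unzip1 _) -/(unzip1 (zip _ t)) !unzip1_zip ?szs.
rewrite (fsbigE _ _ rsU rsA).
  rewrite big_map big_filter_cond /= big_mkcond; apply: eq_big_seq => r rP.
  rewrite (fundamentalE r) -/I; have [cr|] := boolP (compat I r); last by [].
  have rrs : r \in rs by rewrite mem_filter cr.
  have [_ fs ft pr] := fil r rrs.
  have -> : (G r \in [set p | (p.1 `+` p.2)%mset = m]%classic) = true.
    by apply: mem_set; apply: rsA; rewrite /= map_f.
  by rewrite /= !fundamentalE !subE // !compat_subindex // mulr1.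
move=> [p1 p2] /= pm; rewrite !fundamentalE; apply: contraNeq.
rewrite -natrM pnatr_eq0 mulnb eqb0 negbK => /andP[c1 c2].
(* The shuffle hitting a given pair of monomials: sort all labelled letters. *)
pose lexle : rel (nat * nat) := fun p q =>
  (p.1 < q.1)%N || (p.1 == q.1) && (p.2 <= q.2)%N.
have /andP[/eqP sz1 so1] := c1; have /andP[/eqP sz2 so2] := c2.
pose P0 := zip (msort p1) s ++ zip (msort p2) t.
pose P := sort lexle P0; pose r := unzip2 P.
have PP : perm_eq P P0 by rewrite perm_sort.
have rst : perm_eq r (s ++ t).
  by apply: perm_trans (perm_map snd PP) _; rewrite map_cat -!/(unzip2 _) !unzip2_zip ?sz1 ?sz2.
have rU : uniq r by rewrite (perm_uniq rst).
have sole : sorted lexle P.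
  by apply: sort_sorted => -[a1 a2] [b1 b2]; rewrite /lexle /=; lia.
have soP : sorted lexlt P.
  apply/(sortedP (0%N, 0%N)) => i iP.
  have := sole => /(sortedP (0%N, 0%N)) /(_ i iP).
  have : nth 0%N r i != nth 0%N r i.+1.
    by rewrite nth_uniq ?size_map ?(ltnW iP) // ltn_eqF.
  rewrite /r /unzip2 !(nth_map (0%N, 0%N)) ?(ltnW iP) // /lexle /lexlt; lia.
have IP : unzip1 P = I.
  apply: (sorted_eq leq_trans anti_leq).
  - rewrite sorted_map; apply: sub_sorted sole => p q; rewrite /lexle /=; lia.
  - exact: (sort_sorted leq_total).
  apply: perm_trans (perm_map fst PP) _.
  rewrite map_cat -!/(unzip1 _) !unzip1_zip ?sz1 ?sz2 //.
  by apply/eq_seq_msetP; rewrite -addE !seq_mset_msort.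
have zE : zip I r = P by rewrite -IP zip_unzip.
have filE (u v : seq nat) p : compat (msort p) u ->
    perm_eq [seq q <- P0 | q.2 \in u] (zip (msort p) u) ->
    [seq q <- P | q.2 \in u] = zip (msort p) u.
  move=> /andP[/eqP szu sou] pu.
  apply: (irr_sorted_eq lexlt_trans lexlt_irr) => //.
    exact: (sorted_filter lexlt_trans).
  by apply/perm_mem; apply: perm_trans pu; apply: perm_filter.
have disj : {in t, forall x, x \notin s}.
  by move: U; rewrite cat_uniq => /and3P[_ /hasPn].
have in2 (J u : seq nat) q : size J = size u -> q \in zip J u -> q.2 \in u.
  by move=> sJ qz; rewrite -(unzip2_zip (s := J) (t := u)) ?sJ // map_f.
have fsP : [seq q <- P | q.2 \in s] = zip (msort p1) s.
  apply: filE => //; rewrite filter_cat (eq_in_filter (a2 := predT)); last first.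
    by move=> q /(in2 _ _ _ sz1).
  rewrite filter_predT (eq_in_filter (a2 := pred0)) ?filter_pred0 ?cats0 //.
  by move=> q /(in2 _ _ _ sz2) /disj /negbTE.
have ftP : [seq q <- P | q.2 \in t] = zip (msort p2) t.
  apply: filE => //; rewrite filter_cat (eq_in_filter (a2 := pred0)); last first.
    by move=> q /(in2 _ _ _ sz1) qs; apply: contraTF qs => /disj.
  rewrite filter_pred0 (eq_in_filter (a2 := predT)) ?filter_predT //.
  by move=> q /(in2 _ _ _ sz2).
apply/mapP; exists r; last first.
  by rewrite /G /subindex zE fsP ftP !unzip1_zip ?sz1 ?sz2 // !seq_mset_msort.
rewrite mem_filter /compat zE soP andbT -IP !size_map eqxx /=.
have -> : shuffle s t = shuffle [seq x <- r | x \in s] [seq x <- r | predC (mem s) x].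
  congr shuffle.
    by rewrite /r /unzip2 filter_map fsP -/(unzip2 _) unzip2_zip ?sz1.
  rewrite (eq_in_filter (a2 := mem t)) => [|x].
    by rewrite /r /unzip2 filter_map ftP -/(unzip2 _) unzip2_zip ?sz2.
  rewrite (perm_mem rst) mem_cat /=.
  by case: (boolP (x \in t)) => [/disj -> //|_]; rewrite orbF => ->.
exact: (mem_shuffle_filter (mem s)).
Qed.

End FundamentalProduct.

(** * Linear independence and coordinates *)

Fixpoint staircase (i : nat) (v : bword) : seq nat :=
  if v is b :: v' then
    let j := if b then i else i.+1 in j :: staircase j v'
  else [::].

(** The index sequence of the first monomial of F_n: it increases only at the
    descents of [n].  The monomial occurs in F_k only if the descents of [k] are
    among those of [n], which makes the fundamental functions triangular. *)
Definition minimal_index (n : zigzag) : seq nat :=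
  if n is Some v then 0%N :: staircase 0 v else [::].

Definition descents (n : zigzag) : nat := count negb (zword n).

Lemma size_staircase i v : size (staircase i v) = size v.
Proof. by elim: v i => //= b v IHv i; rewrite IHv. Qed.

Lemma staircase_sorted i v : path leq i (staircase i v).
Proof. by elim: v i => //= b v IHv i; rewrite IHv andbT; case: b. Qed.

Lemma staircase_lex i v x s : size s = size v ->
  path lexlt (i, x) (zip (staircase i v) s) =
  all2 (fun b c => c ==> b) (word_from x s) v.
Proof.
elim: v i x s => [|b v IHv] i x [|y s] //= [sz]; rewrite IHv //; congr andb.
by rewrite /lexlt; case: b => /=; rewrite ?ltnn ?eqxx ?ltnSn.
Qed.

Lemma all2_descents (u v : bword) : all2 (fun b c => c ==> b) u v ->
  u = v \/ (count negb u < count negb v)%N.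
Proof.
elim: u v => [|b u IHu] [|c v] //=; first by left.
case/andP => bc /IHu [->|lt].
  by case: b c bc => -[] //= _; [left|right|left].
by right; case: b c bc => -[] //= _; lia.
Qed.

Lemma compat_minimal_index s n : compat (minimal_index n) s ->
  zigzag_of s = n \/ (descents (zigzag_of s) < descents n)%N.
Proof.
case: n => [v|]; last by case: s => [|x s] // _; left.
case: s => [|x s] //; rewrite /compat /= eqSS size_staircase => /andP[/eqP sz].
by rewrite staircase_lex // => /all2_descents[->|lt]; [left | right].
Qed.

Lemma minimal_index_compat s : compat (minimal_index (zigzag_of s)) s.
Proof.
case: s => [|x s] //; rewrite /compat /= eqSS size_staircase size_word_from eqxx /=.
rewrite staircase_lex ?size_word_from //.
by elim: (word_from x s) => //= b u ->; rewrite implybb.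
Qed.

Section Coordinates.
Variable R : realType.
Implicit Types (c : {fsfun zigzag -> R with 0}) (n : zigzag) (L : seq zigzag).

Lemma sum_finsupp_widen (A : {fset zigzag}) c (F : zigzag -> R) :
  (finsupp c `<=` A)%fset ->
  \sum_(n <- finsupp c) c n * F n = \sum_(n <- A) c n * F n.
Proof.
move=> cA; apply: big_fset_incl => // n _ nc.
by rewrite fsfun_dflt // mul0r.
Qed.

Lemma fundamental_minimal n k :
  fundamental R k (seq_mset (minimal_index n)) != 0 ->
  k = n \/ (descents k < descents n)%N.
Proof.
have [s _ <-] := zigzag_of_surj k; rewrite fundamentalE msort_seq_mset.
  by rewrite pnatr_eq0 eqb0 negbK; apply: compat_minimal_index.
by case: n => //= v; apply: staircase_sorted.
Qed.

Lemma fundamental_minimal1 n : fundamental R n (seq_mset (minimal_index n)) = 1.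
Proof.
have [s _ <-] := zigzag_of_surj n; rewrite fundamentalE msort_seq_mset.
  by rewrite minimal_index_compat.
by case: (zigzag_of s) => //= v; apply: staircase_sorted.
Qed.

(** Looking at the minimal monomials, by induction on the number of descents. *)
Lemma fund_comb_inj : injective (@fund_comb R).
Proof.
move=> c c' cc'; pose A := (finsupp c `|` finsupp c')%fset.
have sum0 m : \sum_(n <- A) (c n - c' n) * fundamental R n m = 0.
  have cA : (finsupp c `<=` A)%fset by apply: fsubsetUl.
  have c'A : (finsupp c' `<=` A)%fset by apply: fsubsetUr.
  under eq_bigr do rewrite mulrBl.
  rewrite sumrB -(sum_finsupp_widen _ cA) -(sum_finsupp_widen _ c'A).
  by apply/eqP; rewrite subr_eq0; apply/eqP; apply: (congr1 (fun f => f m) cc').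
suff H d n : descents n = d -> c n - c' n = 0.
  by apply/fsfunP => n; apply/eqP; rewrite -subr_eq0 (H _ _ erefl).
have [nA|] := boolP (n \in A); last first.
  by rewrite inE negb_or => /andP[nc nc'] _; rewrite !fsfun_dflt // subrr.
elim/ltn_ind: d n nA => d IHd n nA nd.
have := sum0 (seq_mset (minimal_index n)).
rewrite (big_fsetD1 n) //= fundamental_minimal1 mulr1 big_seq big1 ?addr0 //.
move=> k; rewrite !inE => /andP[kn kA].
have [->|/fundamental_minimal[kE|lt]] := eqVneq (fundamental R k (seq_mset (minimal_index n))) 0.
- by rewrite mulr0.
- by rewrite kE eqxx in kn.
- by rewrite (IHd (descents k)) ?mul0r ?inE // -nd.
Qed.

Definition comb_of_seq L : {fsfun zigzag -> R with 0} :=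
  [fsfun n in [fset n in L]%fset => (count_mem n L)%:R].

Lemma comb_of_seq_supp L n : n \in finsupp (comb_of_seq L) -> n \in L.
Proof.
by apply: contraLR => nL; rewrite memNfinsupp fsfunE !inE (negbTE nL).
Qed.

Lemma sum_comb_of_seq L (F : zigzag -> R) :
  \sum_(n <- finsupp (comb_of_seq L)) comb_of_seq L n * F n = \sum_(n <- L) F n.
Proof.
rewrite (@sum_finsupp_widen [fset n in L]%fset); last first.
  by apply/fsubsetP => n /comb_of_seq_supp; rewrite inE.
rewrite -[RHS]big_undup_iterop_count /=.
rewrite (perm_big (undup L)); last first.
  by apply: uniq_perm; rewrite ?undup_uniq // => n; rewrite mem_undup inE.
apply: eq_big_seq => n; rewrite mem_undup => nL.
by rewrite fsfunE inE nL mulr_natl.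
Qed.

Lemma fund_coord_sum L :
  fund_coord (fun m => \sum_(n <- L) fundamental R n m) = comb_of_seq L.
Proof.
have E : fund_comb (comb_of_seq L) = fun m => \sum_(n <- L) fundamental R n m.
  by apply/funext => m; apply: (sum_comb_of_seq L (fun n => fundamental R n m)).
by apply: xget_unique => // c /= cE; apply: fund_comb_inj; rewrite E.
Qed.

Lemma eval_qsym_sum (phi : zigzag -> \bar R) (g : zigzag -> R) L :
    {in L, forall n, phi n = (g n)%:E} ->
  eval_qsym phi (fun m => \sum_(n <- L) fundamental R n m) =
  (\sum_(n <- L) g n)%:E.
Proof.
move=> phiE; rewrite /eval_qsym fund_coord_sum -sum_comb_of_seq -sumEFin.
by apply: eq_big_seq => n /comb_of_seq_supp /phiE ->; rewrite EFinM.
Qed.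

Lemma eval_qsym_fundamental (phi : zigzag -> \bar R) (x : R) n :
  phi n = x%:E -> eval_qsym phi (fundamental R n) = x%:E.
Proof.
move=> phiE.
have -> : fundamental R n = fun m => \sum_(k <- [:: n]) fundamental R k m.
  by apply/funext => m; rewrite big_seq1.
rewrite (@eval_qsym_sum phi (fun=> x)) ?big_seq1 // => k.
by rewrite inE => /eqP ->.
Qed.

End Coordinates.

(** * Functionals given by a list of factors *)

Section Factors.
Variable R : realType.
Implicit Types (s t r : seq nat) (v : seq (R * bool)) (h : zigzag).

(** The left summand stands for a section, given by its oriented numbers, and the
    right summand for a gap, given by the zigzag inside it. *)
Definition factor := (seq (R * bool) + zigzag)%type.
Implicit Types (f : factor) (fs : seq factor).

Definition fval f : seq nat -> R :=
  match f with inl v => chis v | inr h => @delta R h end.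

(** What a factor contributes to the multiplicative companion of the functional:
    on the first argument of a product the gaps act as the neutral functional. *)
Definition fchar f : seq nat -> R :=
  match f with inl v => chis v | inr _ => @counit R end.

(** The order of the zigzag graph; the comparison of the sizes tells the empty
    zigzag from the box, whose words are both empty. *)
Definition below t h : bool :=
  (size t <= zsize h)%N && subseq (word t) (zword h).

Definition fweak f t : bool :=
  match f with inl v => chis v t != 0 | inr h => below t h end.

Definition fstrict f t : bool :=
  match f with inl _ => false | inr h => (size t < zsize h)%N end.

Definition factor_conv fs : seq nat -> R := foldr (fun f g => conv (fval f) g) (@counit R) fs.
Definition char_conv fs : seq nat -> R :=
  foldr (fun f g => conv (fchar f) g) (@counit R) fs.

(** A cut of [t] into pieces allowed by the factors; the flag [st] records whether
    the piece of some gap is strictly smaller than the zigzag of that gap. *)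
Fixpoint cut fs (st : bool) t : Prop :=
  if fs is f :: fs' then exists t1 t2 st',
    [/\ t = t1 ++ t2, fweak f t1, cut fs' st' t2 & st = fstrict f t1 || st']
  else t = [::] /\ st = false.

Lemma char_convE fs : char_conv fs =1
  chis (flatten [seq if f is inl v then v else [::] | f <- fs]).
Proof.
elim: fs => [|f fs IH] t //=; case: f => [v|h] /=.
  by rewrite chis_cat; apply: eq_conv.
by rewrite conv_counit IH.
Qed.

Lemma sum_neq0 n (F : 'I_n -> R) : \sum_(i < n) F i != 0 -> exists i, F i != 0.
Proof.
move=> nz; apply/existsP; apply: contraNT nz => /existsPn H.
by rewrite big1 // => i _; apply/eqP; have := H i; rewrite negbK.
Qed.

Lemma below_shuffle s t r h : r \in shuffle s t -> zigzag_of r = h ->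
  below t h /\ (s != [::] -> (size t < zsize h)%N).
Proof.
move=> rP <-; rewrite /below zsize_zigzag_of (perm_size (shuffle_perm rP)) size_cat.
rewrite leq_addl (subseq_word (shuffle_subseq rP)); split=> // s0.
by rewrite -[X in (X < _)%N]add0n ltn_add2r lt0n size_eq0.
Qed.

(** For a gap [h], a shuffle of [s] and [t] of pattern [h] is longer than [t] unless
    [s] is empty, in which case both sides are the indicator of [h] at [t]. *)
Lemma fval_shuffle_sum f s t : uniq (s ++ t) ->
  shuffle_sum (fval f) s t = fchar f s * fval f t \/ fweak f t && fstrict f t.
Proof.
case: f => [v|h] U /=; first by left; apply: shuffle_sum_chis.
have [->|s0] := eqVneq s [::]; first by left; rewrite shuffle_sum0s /counit eqxx mul1r.
have [/hasP[r rP /eqP rh]|/hasPn nh] := boolP (has (fun r => zigzag_of r == h) (shuffle s t)).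
  by have [-> /(_ s0) ->] := below_shuffle rP rh; right.
left; rewrite /counit (negbTE s0) mul0r /shuffle_sum big1_seq // => r /andP[_ /nh].
by rewrite /delta => /negbTE ->.
Qed.

Lemma fweak_shuffle_sum f s t : uniq (s ++ t) -> shuffle_sum (fval f) s t != 0 -> fweak f t.
Proof.
case: f => [v|h] U /=.
  by rewrite shuffle_sum_chis // mulf_eq0 => /norP[].
move=> nz; have /hasP[r rP /eqP rh] : has (fun r => zigzag_of r == h) (shuffle s t).
  apply: contraNT nz => /hasPn nh; rewrite /shuffle_sum big1_seq // => r /andP[_ /nh].
  by rewrite /delta => /negbTE ->.
by have [] := below_shuffle rP rh.
Qed.

Lemma fweak_fval f t : uniq t -> fval f t != 0 -> fweak f t.
Proof. by move=> U nz; apply: (@fweak_shuffle_sum _ [::]); rewrite ?shuffle_sum0s. Qed.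

Lemma uniq_take s t i j : uniq (s ++ t) -> uniq (take i s ++ take j t).
Proof. by apply: subseq_uniq; apply: cat_subseq; apply: take_subseq. Qed.

Lemma uniq_drop s t i j : uniq (s ++ t) -> uniq (drop i s ++ drop j t).
Proof. by apply: subseq_uniq; apply: cat_subseq; apply: drop_subseq. Qed.

Lemma cut_shuffle_sum fs s t : uniq (s ++ t) -> shuffle_sum (factor_conv fs) s t != 0 ->
  exists st, cut fs st t.
Proof.
elim: fs s t => [|f fs IH] s t U /=.
  rewrite shuffle_sum_counit mulf_eq0 => /norP[_]; rewrite /counit pnatr_eq0 eqb0 negbK => /eqP ->.
  by exists false.
rewrite shuffle_sum_conv => /sum_neq0[i /sum_neq0[j]].
rewrite mulf_eq0 => /norP[/fweak_shuffle_sum-/(_ (uniq_take _ _ U)) wk].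
case/(IH _ _ (uniq_drop _ _ U)) => st cst.
exists (fstrict f (take j t) || st), (take j t), (drop j t), st.
by rewrite cat_take_drop.
Qed.

Lemma cut_factor_conv fs t : uniq t -> factor_conv fs t != 0 -> exists st, cut fs st t.
Proof. by move=> U nz; apply: (@cut_shuffle_sum fs [::]); rewrite ?shuffle_sum0s. Qed.

(** A term of the sum over cuts that does not factor has a gap in which the first
    argument has a nonempty piece; if it is nonzero, the pieces of [t] form a cut
    with a strictly smaller gap piece, which is excluded. *)
Lemma factor_conv_shuffle_sum fs s t : uniq (s ++ t) -> ~ cut fs true t ->
  shuffle_sum (factor_conv fs) s t = char_conv fs s * factor_conv fs t.
Proof.
elim: fs s t => [|f fs IH] s t U nc /=; first exact: shuffle_sum_counit.
rewrite shuffle_sum_conv mulr_suml; apply: eq_bigr => i _.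
rewrite mulr_sumr; apply: eq_bigr => j _.
have U1 := uniq_take i j U; have U2 := uniq_drop i j U.
have ncut st : cut fs st (drop j t) -> fweak f (take j t) ->
    fstrict f (take j t) || st = false.
  move=> c wk; apply/negbTE/negP => T; apply: nc.
  by exists (take j t), (drop j t), st; rewrite cat_take_drop T.
have fval0 : ~~ fweak f (take j t) -> fval f (take j t) = 0.
  move=> nwk; apply/eqP; apply: contraNT nwk; apply: fweak_fval.
  by move: U1; rewrite cat_uniq => /and3P[].
(* Either the tail vanishes, or it provides a cut of the rest of [t], so that the
   first piece cannot be strict. *)
have [E|ne] := eqVneq (shuffle_sum (factor_conv fs) (drop i s) (drop j t)) 0.
  rewrite E mulr0; have [wk|nwk] := boolP (fweak f (take j t)).
    rewrite mulrACA -IH ?E ?mulr0 // => c.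
    by have := ncut _ c wk; rewrite orbT.
  by rewrite fval0 // mul0r mulr0.
have [st c] := cut_shuffle_sum U2 ne.
have [->|/andP[wk str]] := fval_shuffle_sum f U1; last first.
  by have := ncut _ c wk; rewrite str.
have [wk|nwk] := boolP (fweak f (take j t)).
  rewrite IH 1?mulrACA // => ct.
  by have := ncut _ ct wk; rewrite orbT.
by rewrite fval0 // !(mulr0, mul0r).
Qed.

Lemma conv_unique (f g : seq nat -> R) t i0 : (i0 <= size t)%N ->
    (forall i, (i <= size t)%N -> f (take i t) != 0 -> g (drop i t) != 0 -> i = i0) ->
  conv f g t = f (take i0 t) * g (drop i0 t).
Proof.
move=> i0t H; pose k0 := Ordinal (i0t : (i0 < (size t).+1)%N).
rewrite /conv (bigD1 k0) //= big1 ?addr0 // => i ik0.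
apply/eqP; apply: contraNT ik0; rewrite mulf_eq0 => /norP[nf ng].
by apply/eqP/val_inj; rewrite /= (H i) // -ltnS.
Qed.

End Factors.

(** * Words of a sequence of clusters *)

(** The binary words of the nonempty zigzags in Z(r). *)
Fixpoint lang (r : seq cluster) (w : bword) : Prop :=
  if r is c :: r' then exists l w', [/\ le_mult l c.2, w = nseq l (csign c) ++ w' & lang r' w']
  else w = [::].

Lemma ZsetE r w : Zset r (Some w) <-> lang r w.
Proof.
split.
  case=> [//|[k sk [H [->]]]]; elim: r k sk H => [|c r IH] [|l k] //= [sk] H.
  exists l, (flatten [seq nseq p.1 (csign p.2) | p <- zip k r]); split=> //.
    exact: (H 0%N).
  by apply: IH => // i ir; apply: (H i.+1).
move=> L; right; elim: r w L => [|c r IH] w /=.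
  by move=> ->; exists [::].
case=> l [w' [lc -> /IH [k sk [H [->]]]]]; exists (l :: k); rewrite /= ?sk //.
by split=> // -[|i] //=; apply: H.
Qed.

Lemma lang_cat r1 r2 w :
  lang (r1 ++ r2) w <-> exists u v, [/\ w = u ++ v, lang r1 u & lang r2 v].
Proof.
elim: r1 w => [|c r1 IH] w /=.
  split=> [L|[u [v [-> -> L]]]] //; by exists [::], w.
split=> [[l [w' [lc -> /IH [u [v [-> L1 L2]]]]]]|].
  by exists (nseq l (csign c) ++ u), v; rewrite catA; split=> //; exists l, u.
case=> u [v [-> [l [u' [lc -> L1]]] L2]]; exists l, (u' ++ v); rewrite catA.
by split=> //; apply/IH; exists u', v.
Qed.

Lemma lang_catI r1 r2 u v : lang r1 u -> lang r2 v -> lang (r1 ++ r2) (u ++ v).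
Proof. by move=> L1 L2; apply/lang_cat; exists u, v. Qed.

Lemma subseq_cat (T : eqType) (w u v : seq T) : subseq w (u ++ v) ->
  exists w1 w2, [/\ w = w1 ++ w2, subseq w1 u & subseq w2 v].
Proof.
elim: u w => [|a u IH] w /=; first by exists [::], w.
case: w => [|b w]; first by exists [::], [::]; rewrite !sub0seq.
case: eqP => [->|ne] /IH [w1 [w2 [E s1 s2]]].
  by exists (a :: w1), w2; rewrite E /= eqxx.
exists w1, w2; split=> //; exact: subseq_trans s1 (subseq_cons _ _).
Qed.

Lemma subseq_nseq (T : eqType) (w : seq T) n a : subseq w (nseq n a) ->
  w = nseq (size w) a /\ (size w <= n)%N.
Proof.
move=> sw; split; last by have := size_subseq sw; rewrite size_nseq.
by apply/all_pred1P; apply/allP => x /(mem_subseq sw); rewrite mem_nseq => /andP[].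
Qed.

Lemma lang_subseq r w w' : lang r w -> subseq w' w -> lang r w'.
Proof.
elim: r w w' => [|c r IH] w w' /=; first by move=> ->; rewrite subseq0 => /eqP.
case=> l [v [lc -> L]] /subseq_cat [w1 [w2 [-> /subseq_nseq[E le1] /(IH _ _ L) L2]]].
exists (size w1), w2; split=> //; last by rewrite -E.
by case: (c.2) lc => //= k; apply: leq_trans.
Qed.

Lemma lang_nil r : lang r [::].
Proof. by elim: r => //= c r IH; exists 0%N, [::]; split=> //; case: (c.2). Qed.

Lemma lang_finite r w : all finite_cluster r ->
  lang r w <-> subseq w (cluster_word r).
Proof.
elim: r w => [|c r IH] w; first by rewrite [cluster_word _]/= subseq0; split=> [->|/eqP].
case/andP; case: c => b [k|] // _ fr; rewrite /cluster_word /=; split.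
  case=> l [w' [lk -> /(IH _ fr) sw]]; apply: cat_subseq => //.
  by rewrite -(subnKC lk) nseqD prefix_subseq.
case/subseq_cat => w1 [w2 [-> /subseq_nseq[E le1] s2]].
by exists (size w1), w2; split; rewrite -?E //; apply/(IH _ fr).
Qed.

(** * Pieces read along a section *)

(** The possible shapes of a section, with the signs of its first and last
    clusters: infinite clusters, where two neighbours of the same sign are
    separated by a single cluster of multiplicity 1. *)
Inductive run_shape : bool -> seq cluster -> bool -> Prop :=
| run1 s : run_shape s [:: (s, None)] s
| run_adj s T e : run_shape (~~ s) T e -> run_shape s ((s, None) :: T) e
| run_sep s T e : run_shape s T e ->
    run_shape s ((s, None) :: (~~ s, Some 1%N) :: T) e.

Definition csigns (T : seq cluster) := [seq csign c | c <- T & infinite_cluster c].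

Lemma run_absorb s T e w : run_shape s T e -> lang T w -> lang T (w ++ [:: e]).
Proof.
move=> C; elim: C w => {s T e} [s|s T e _ IH|s T e _ IH] w.
- case=> l [w' [_ -> ->]]; exists l.+1, [::]; split=> //.
  by rewrite !cats0 -addn1 nseqD.
- case=> l [w' [lc -> /IH L]]; exists l, (w' ++ [:: e]).
  by rewrite catA.
- case=> l [w' [lc -> [l' [w'' [lc' -> /IH L]]]]].
  exists l, (nseq l' (~~ s) ++ (w'' ++ [:: e])); rewrite -!catA; split=> //.
  by exists l', (w'' ++ [:: e]).
Qed.

(** The letter that precedes a piece is either part of the word of the section that
    starts with sign [s], or it is a single letter of the opposite sign left over
    for whatever stands on the left. *)
Definition junction (s : bool) (jj : bword) := jj = [::] \/ jj = [:: ~~ s].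

Section Pieces.
Variable R : realType.
Implicit Types (t : seq nat) (v : seq (R * bool)).

Lemma chi_word_from (u : R * bool) t x : chi u t != 0 ->
  exists jj n, junction u.2 jj /\ word_from x t = jj ++ nseq n u.2.
Proof.
rewrite /chi; case: ifP; rewrite ?eqxx //.
case: t => [|y t] st _; first by exists [::], 0%N; split=> //; left.
have := st; rewrite word_cons => /all_pred1P E; rewrite /= E.
case: (eqVneq (x < y)%N u.2) => [->|ne].
  by exists [::], (size (word_from y t)).+1; split=> //; left.
exists [:: ~~ u.2], (size (word_from y t)); split; first by right.
by case: u.2 ne; case: (x < y)%N.
Qed.

Lemma conv_neq0 (f g : seq nat -> R) t : conv f g t != 0 ->
  exists t1 t2, [/\ t = t1 ++ t2, f t1 != 0 & g t2 != 0].
Proof.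
move=> /sum_neq0[i]; rewrite mulf_eq0 => /norP[nf ng].
by exists (take i t), (drop i t); rewrite cat_take_drop.
Qed.

(** At a junction between two infinite clusters, the letter between two pieces is
    absorbed by one of the clusters or fills the separating cluster. *)
Lemma run_word_from s T e v t x : run_shape s T e -> map snd v = csigns T ->
  chis v t != 0 ->
  exists jj w, [/\ junction s jj, word_from x t = jj ++ w & lang T w].
Proof.
move=> C; elim: C v t x => {s T e} [s|s T e C IH|s T e C IH] [|u v] t x //=.
- case=> us; case: v => // _ /conv_neq0[t1 [t2 [-> c1]]].
  rewrite /counit pnatr_eq0 eqb0 negbK => /eqP ->; rewrite cats0.
  have [jj [n [J E]]] := chi_word_from x c1; rewrite us in J E.
  exists jj, (nseq n s); split=> //; exists n, [::]; split=> //; by rewrite cats0.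
- case=> us vs /conv_neq0[t1 [t2 [-> c1 /(IH _ _ (last x t1) vs)]]].
  case=> jj2 [w2 [J2 E2 L2]].
  have [jj [n [J E]]] := chi_word_from x c1; rewrite us in J E.
  exists jj, (nseq n s ++ (jj2 ++ w2)); split=> //.
    by rewrite word_from_cat E E2 !catA.
  case: J2 => ->; first by exists n, w2.
  exists n.+1, w2; split=> //.
  by rewrite negbK -[[:: s]]/(nseq 1 s) catA -nseqD addn1.
- case=> us vs /conv_neq0[t1 [t2 [-> c1 /(IH _ _ (last x t1) vs)]]].
  case=> jj2 [w2 [J2 E2 L2]].
  have [jj [n [J E]]] := chi_word_from x c1; rewrite us in J E.
  exists jj, (nseq n s ++ (jj2 ++ w2)); split=> //.
    by rewrite word_from_cat E E2 !catA.
  exists n, (jj2 ++ w2); split=> //.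
  by case: J2 => ->; [exists 0%N, w2 | exists 1%N, w2].
Qed.

End Pieces.

(** * Pieces read along a semifinite template *)

Section Blocks.
Variable R : realType.
Implicit Types (t : seq nat) (v : seq (R * bool)).

(** A section, the gap that follows it, and the oriented numbers assigned to the
    infinite clusters of the section. *)
Definition block := (seq cluster * seq cluster * seq (R * bool))%type.
Implicit Types (bs : seq block).

(** The zigzag of the boxes strictly inside a gap of word [g] that follows a
    section: the first letter of [g] joins it to the left section, and, unless
    the gap is the last one, the last letter joins it to the right section. *)
Definition gap_zigzag (isl : bool) (g : bword) : zigzag :=
  if isl then (if g is _ :: g' then Some g' else None)
  else Some (behead (take (size g).-1 g)).

Fixpoint block_factors bs : seq (factor R) :=
  if bs is (_, A, v) :: bs' then
    [:: inl v, inr (gap_zigzag (nilp bs') (cluster_word A)) & block_factors bs']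
  else [::].

(** The words of a sequence of blocks; the flag [st] records whether some gap is
    represented by a proper subword, which puts the word in J(t). *)
Fixpoint block_lang bs (st : bool) (w : bword) : Prop :=
  if bs is (T, A, _) :: bs' then exists x y z st',
    [/\ [/\ w = x ++ y ++ z, lang T x & subseq y (cluster_word A)], block_lang bs' st' z
      & st = (size y < size (cluster_word A))%N || st']
  else w = [::] /\ st = false.

(** The shape of the part of a semifinite template that starts at a section, with
    its first sign.  An inner gap begins with the sign opposite to the cluster on
    its left and ends with the sign opposite to the cluster on its right; these
    are two letters of the gap, because an inner gap of one letter would be a
    separating cluster. *)
Inductive well_formed : bool -> seq block -> Prop :=
| well_formed_last s T e A v : run_shape s T e -> map snd v = csigns T ->
    cluster_word A = [::] \/ (exists g, cluster_word A = ~~ e :: g) ->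
    well_formed s [:: (T, A, v)]
| well_formed_cons s T e A v g s' bs : run_shape s T e -> map snd v = csigns T ->
    cluster_word A = ~~ e :: rcons g (~~ s') -> well_formed s' bs ->
    well_formed s ((T, A, v) :: bs).

Lemma block_lang_subseq bs st w w' : block_lang bs st w -> subseq w' w ->
  exists st', block_lang bs st' w' /\ (st -> st').
Proof.
elim: bs st w w' => [|[[T A] v] bs IH] st w w' /=.
  by case=> -> ->; rewrite subseq0 => /eqP ->; exists false.
case=> x [y [z [st1 [[-> Lx sy] Lz ->]]]].
case/subseq_cat => x' [w1 [-> sx /subseq_cat[y' [z' [-> sy' sz]]]]].
have [st2 [Lz' imp]] := IH _ _ _ Lz sz.
exists ((size y' < size (cluster_word A))%N || st2); split.
  exists x', y', z', st2; split=> //; split=> //; first exact: lang_subseq sx.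
  exact: subseq_trans sy' sy.
by case/orP => [lt|/imp ->]; rewrite ?orbT // (leq_ltn_trans (size_subseq sy')).
Qed.

(** If the letter before a gap piece is not the first letter of the gap, it has the
    sign [e] of the infinite cluster on the left; it is handed over to it, and
    the rest is too short to fill the gap. *)
Lemma gap_word_from e g t x : (size t <= (size g).+1)%N -> subseq (word t) g ->
  exists jj y, [/\ word_from x t = jj ++ y, subseq y (~~ e :: g) &
    (jj = [::] /\ size y = size t) \/ (jj = [:: e] /\ (size y < (size g).+1)%N)].
Proof.
case: t => [|z t] st sw; first by exists [::], [::]; split=> //; left.
rewrite /= -/(word_from z t); case: (eqVneq (x < z)%N e) => [->|ne].
  exists [:: e], (word_from z t); split=> //; last by right; rewrite size_word_from.
  exact: subseq_trans sw (subseq_cons _ _).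
exists [::], ((x < z)%N :: word_from z t); split=> //.
  by have -> : (x < z)%N = ~~ e by [case: e ne; case: (x < z)%N]; rewrite /= eqxx.
by left; rewrite /= size_word_from.
Qed.

(** The word read from a gap piece [t2] and the pieces [t3] after it: the letters
    [jj] absorbed on the left, a subword [y] of the gap, and a word of the
    remaining blocks.  Either [y] is a proper subword, or the cut falls exactly
    at the borders of the gap. *)
Definition gap_reading e (g : bword) bs (st : bool) (t2 t3 : seq nat) x :=
  exists jj y w st', [/\ word_from x (t2 ++ t3) = jj ++ y ++ w,
    jj = [::] \/ jj = [:: e], subseq y g, block_lang bs st' w & (st -> st') /\
    ((size y < size g)%N \/
     [/\ jj = [::], y = g, size t2 = (size g - ~~ nilp bs)%N &
      w = word t3 /\ (bs = [::] \/ t3 != [::])])].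

Lemma gap_reading_last e A t x :
  cluster_word A = [::] \/ (exists g, cluster_word A = ~~ e :: g) ->
  below t (gap_zigzag true (cluster_word A)) ->
  gap_reading e (cluster_word A) [::] false t [::] x.
Proof.
case=> [->|[g ->]]; rewrite /below /=.
  rewrite leqn0 size_eq0 => /andP[/eqP -> _].
  exists [::], [::], [::], false; split=> //; first by left.
  by split=> //; right; split=> //; split=> //; left.
case/andP => st /(gap_word_from e x st)[jj [y [E sy H]]].
exists jj, y, [::], false; rewrite !cats0; split=> //.
  by case: H => -[-> _]; [left|right].
split=> //; case: H => -[jE sz]; last by left.
have [lt|ge] := ltnP (size y) (size (~~ e :: g)); first by left.
right; split=> //; last by split=> //; left.
  apply/eqP; rewrite -(geq_leqif (size_subseq_leqif sy)) //.
rewrite /= subn0 -sz; apply/eqP.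
by rewrite eqn_leq -[X in (_ <= X)%N]/(size (~~ e :: g)) (size_subseq sy).
Qed.

Lemma gap_reading_cons e g s bs (st : bool) t2 t3 x : bs != [::] ->
  (forall x, exists jj w st', [/\ junction s jj, word_from x t3 = jj ++ w,
     block_lang bs st' w & (st -> st')]) ->
  below t2 (Some g) -> gap_reading e (~~ e :: rcons g (~~ s)) bs st t2 t3 x.
Proof.
move=> bs0 H /andP[/= le2 /(gap_word_from e x le2)[jj [y [E sy J]]]].
have [jj3 [w [st' [J3 E3 Lw imp]]]] := H (last x t2).
exists jj, (y ++ jj3), w, st'; split=> //.
- by rewrite word_from_cat E E3 !catA.
- by case: J => -[-> _]; [left|right].
- rewrite -cats1 -cat_cons; apply: cat_subseq => //.
  by case: J3 => ->; rewrite ?sub0seq //= eqxx.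
split=> //; rewrite /= size_rcons size_cat.
have sz := size_subseq sy; rewrite /= in sz.
case: J => -[jE yE]; last first.
  by left; case: J3 => -> /=; rewrite ?addn0 ?addn1 ?(leqW yE).
case: J3 => jE3; subst jj3; first by left; rewrite /= addn0 ltnS.
have [lt|ge] := ltnP (size y) (size g).+1; first by left; rewrite /= addn1 ltnS.
right; split=> //.
- rewrite (_ : y = ~~ e :: g) ?cats1 //.
  by apply/eqP; rewrite -(geq_leqif (size_subseq_leqif sy)).
- have -> : ~~ nilp bs by case: (bs) bs0.
  by rewrite -yE subn1 /=; apply/eqP; rewrite eqn_leq sz ge.
case: t3 H E3 => [|z t3] // _ [_ <-]; split=> //; by right.
Qed.

Lemma gap_zigzag_inner a b g : gap_zigzag false (a :: rcons g b) = Some g.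
Proof. by rewrite /gap_zigzag -rcons_cons size_rcons -cats1 take_size_cat. Qed.

Lemma zsize_gap_last e (g : bword) : g = [::] \/ (exists g', g = ~~ e :: g') ->
  zsize (gap_zigzag true g) = size g.
Proof. by case=> [->|[g' ->]]. Qed.

Lemma block_step s T e A v bs (st : bool) t1 t2 t3 x :
  run_shape s T e -> map snd v = csigns T -> chis v t1 != 0 ->
  gap_reading e (cluster_word A) bs st t2 t3 (last x t1) ->
  exists jj w st', [/\ junction s jj, word_from x (t1 ++ t2 ++ t3) = jj ++ w,
    block_lang ((T, A, v) :: bs) st' w &
    (size t2 < size (cluster_word A) - ~~ nilp bs)%N || st -> st'].
Proof.
move=> C vs c1; have [jj1 [w1 [J1 E1 L1]]] := run_word_from x C vs c1.
case=> jj [y [w [st' [E J sy Lw [imp H]]]]].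
exists jj1, ((w1 ++ jj) ++ y ++ w), ((size y < size (cluster_word A))%N || st').
split=> //.
- by rewrite word_from_cat E1 E !catA.
- exists (w1 ++ jj), y, w, st'; split=> //; split=> //.
  by case: J => ->; rewrite ?cats0 //; apply: run_absorb C _.
case: H => [-> //|[_ _ -> _]].
by rewrite ltnn /= => /imp ->; rewrite orbT.
Qed.

(** A uniform description of the first block, whether it is the last block or not. *)
Lemma well_formed_inv s T A v bs : well_formed s ((T, A, v) :: bs) -> exists e,
  [/\ run_shape s T e, map snd v = csigns T,
    zsize (gap_zigzag (nilp bs) (cluster_word A)) =
      (size (cluster_word A) - ~~ nilp bs)%N,
    (bs != [::] -> cluster_word A != [::] /\ exists s', well_formed s' bs) &
    (forall (st : bool) t2 t3 x,
      (forall s', well_formed s' bs -> forall x, exists jj w st', [/\ junction s' jj,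
         word_from x t3 = jj ++ w, block_lang bs st' w & (st -> st')]) ->
      below t2 (gap_zigzag (nilp bs) (cluster_word A)) ->
      (bs = [::] -> t3 = [::] /\ st = false) ->
      gap_reading e (cluster_word A) bs st t2 t3 x)].
Proof.
move=> G; inversion G as [s0 T0 e A0 v0 C vs AE|s0 T0 e A0 v0 g s' bs0 C vs AE G']; subst.
  exists e; split=> //; first by rewrite (zsize_gap_last AE) subn0.
  by move=> st t2 t3 x _ b2 /(_ erefl) [-> ->]; apply: gap_reading_last.
have bs0 : bs != [::] by case: G'.
have nbs : nilp bs = false by case: (bs) bs0.
exists e; split=> //.
- by rewrite nbs AE gap_zigzag_inner /= size_rcons subn1.
- by rewrite AE; split=> //; exists s'.
move=> st t2 t3 x H; rewrite nbs AE gap_zigzag_inner => b2 _.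
by apply: gap_reading_cons => //; apply: H.
Qed.

(** The letters between the pieces are absorbed by infinite clusters or complete
    the gaps, and a gap whose piece is too small stays incomplete. *)
Lemma block_word_from bs s st t x : well_formed s bs -> cut (block_factors bs) st t ->
  exists jj w st', [/\ junction s jj, word_from x t = jj ++ w, block_lang bs st' w &
    (st -> st')].
Proof.
elim: bs s st t x => [|[[T A] v] bs IH] s st t x G; first by inversion G.
have [e [C vs zs _ read]] := well_formed_inv G.
case=> t1 [_ [_ [-> c1 [t2 [t3 [st2 [-> b2 c3 ->]]]] ->]]].
have R3 : gap_reading e (cluster_word A) bs st2 t2 t3 (last x t1).
  apply: read => //; first by move=> s' G' y; apply: IH c3.
  by move=> bs0; move: c3; rewrite bs0.
have [jj [w [st' [J E L imp]]]] := block_step C vs c1 R3.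
by exists jj, w, st'; split=> //; rewrite /= zs.
Qed.

Lemma block_word bs s st t : well_formed s bs -> cut (block_factors bs) st t ->
  exists st', block_lang bs st' (word t) /\ (st -> st').
Proof.
move=> G c; have [jj [w [st1 [J E L imp]]]] := block_word_from 0 G c.
have [|st' [L' imp']] := @block_lang_subseq _ _ _ (word t) L.
  rewrite (word_behead 0) E; case: J => -> //=.
  by case: (w) => //= b u; apply: subseq_cons.
by exists st'; split=> // /imp.
Qed.

(** Suppose that [b1], on the right of an occurrence of the gap [g], is a word of the
    remaining blocks, and that the left part [a2] of a later occurrence of [g] is
    a word of the section.  Then the letters after [a2] form a proper suffix of
    [g ++ b1], that is, a proper suffix of [g] followed by a word of the
    remaining blocks. *)
Lemma block_lang_shift T A v bs a1 a2 st1 b1 b2 :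
  lang T a2 -> block_lang bs st1 b1 ->
  a1 ++ cluster_word A ++ b1 = a2 ++ cluster_word A ++ b2 ->
  (size a1 < size a2)%N -> cluster_word A != [::] ->
  block_lang ((T, A, v) :: bs) true (a2 ++ cluster_word A ++ b2).
Proof.
set g := cluster_word A => L2 Lb E lt g0.
have E2 : g ++ b2 = drop (size a2 - size a1) (g ++ b1).
  have := congr1 (drop (size a2)) E; rewrite [RHS]drop_size_cat // => <-.
  by rewrite drop_cat ltnNge (ltnW lt).
rewrite E2 drop_cat; case: ltnP => [ltg|_].
  exists a2, (drop (size a2 - size a1) g), b1, st1; split=> //.
    by split=> //; apply: drop_subseq.
  by rewrite size_drop ltn_subrL subn_gt0 lt lt0n size_eq0 g0.
have [st' [Lb' _]] := block_lang_subseq Lb (drop_subseq b1 (size a2 - size a1 - size g)).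
exists a2, [::], (drop (size a2 - size a1 - size g) b1), st'; split=> //.
  by split=> //; apply: sub0seq.
by rewrite /= lt0n size_eq0 g0.
Qed.

(** Outside J(t) a cut cannot be moved: one of the two shifts would show that the
    word belongs to J(t). *)
Lemma block_cut_size s T A v bs l st0 z t st t1 t2 t3 :
    well_formed s ((T, A, v) :: bs) -> lang T l -> block_lang bs st0 z ->
    word t = l ++ cluster_word A ++ z -> t != [::] ->
    ~ block_lang ((T, A, v) :: bs) true (word t) ->
    t = t1 ++ t2 ++ t3 -> chis v t1 != 0 ->
    below t2 (gap_zigzag (nilp bs) (cluster_word A)) ->
    cut (block_factors bs) st t3 ->
  size t1 = (size l).+1.
Proof.
move=> G Ll Lz tE t0 nJ tt c1 b2 c3.
have [e [C vs zs gne read]] := well_formed_inv G.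
have R3 x : gap_reading e (cluster_word A) bs st t2 t3 x.
  apply: read => //; first by move=> s' G' y; apply: block_word_from c3.
  by move=> bs0; move: c3; rewrite bs0.
case: t1 => [|a t1] in tt c1 *.
  have [jj [y [w [st' [E J sy Lw [imp H]]]]]] := R3 0%N.
  have wE : word t = behead (jj ++ y ++ w) by rewrite tt cat0s (word_behead 0) E.
  (* An empty section piece leaves the first letter of the gap without a box. *)
  case: nJ; case: H => [lt|[jE yE szt2 [_ bst3]]].
    have L0 : block_lang ((T, A, v) :: bs) true (y ++ w).
      by exists [::], y, w, st'; rewrite lt; split=> //; split=> //; apply: lang_nil.
    have [|st2 [L2 /(_ isT) st2T]] := block_lang_subseq (w' := word t) L0.
      rewrite wE; case: J => -> //=; rewrite -drop1; exact: drop_subseq.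
    by rewrite st2T in L2.
  rewrite wE jE yE /=; case gE: (cluster_word A) => [|b g].
    case: (eqVneq bs [::]) => [bsE|/gne[]]; last by rewrite gE.
    move: c3 szt2 t0; rewrite bsE gE tt => -[-> _] /eqP.
    by rewrite sub0n size_eq0 => /eqP ->.
  exists [::], g, w, st'; rewrite /= ltnSn; split=> //; split=> //.
    exact: lang_nil.
  exact: subseq_cons.
have [jj [y [w [st' [E J sy Lw [imp H]]]]]] := R3 (last a t1).
have wE : word t = word_from a t1 ++ jj ++ y ++ w.
  by rewrite tt cat_cons word_cons word_from_cat E.
have L1 : lang T (word_from a t1).
  have [jj1 [w1 [J1 E1 L1]]] := run_word_from 0 C vs c1.
  apply: lang_subseq L1 _; rewrite -word_cons (word_behead 0) E1.
  case: J1 => -> //=; rewrite -drop1; exact: drop_subseq.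
case: H => [lt|[jE yE szt2 [w3 bst3]]].
  case: nJ; rewrite wE; exists (word_from a t1 ++ jj), y, w, st'; rewrite lt -catA.
  by split=> //; split=> //; case: J => ->; rewrite ?cats0 //; apply: run_absorb C _.
rewrite jE yE cat0s in wE; rewrite /= -(size_word_from a t1); congr _.+1.
case: (ltngtP (size (word_from a t1)) (size l)) => // lt; exfalso.
  case: (eqVneq bs [::]) => [bsE|/gne[g0 _]].
    move: wE; rewrite tE; move: Lz Lw; rewrite bsE => -[-> _] [-> _].
    by move/(congr1 size)/eqP; rewrite !size_cat eqn_add2r gtn_eqF.
  by apply: nJ; rewrite tE; apply: (block_lang_shift v Ll Lw _ lt g0); rewrite -wE.
case: (eqVneq bs [::]) => [bsE|/gne[g0 _]].
  move: wE; rewrite tE; move: Lz Lw; rewrite bsE => -[-> _] [-> _].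
  by move/(congr1 size)/eqP; rewrite !size_cat eqn_add2r ltn_eqF.
by apply: nJ; rewrite wE; apply: (block_lang_shift v L1 Lz _ lt g0); rewrite -tE.
Qed.

End Blocks.

(** * Values of the functional off J(t) *)

Section BlockValues.
Variable R : realType.
Implicit Types (t : seq nat) (v : seq (R * bool)) (bs : seq (block R)).

Fixpoint block_join bs (ls : seq bword) : bword :=
  match bs, ls with
  | (_, A, _) :: bs', l :: ls' => l ++ cluster_word A ++ block_join bs' ls'
  | _, _ => [::]
  end.

Fixpoint block_words bs (ls : seq bword) : Prop :=
  match bs, ls with
  | (T, _, _) :: bs', l :: ls' => lang T l /\ block_words bs' ls'
  | [::], [::] => True
  | _, _ => False
  end.

Lemma block_join_lang bs ls : block_words bs ls ->
  block_lang bs false (block_join bs ls).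
Proof.
elim: bs ls => [|[[T A] v] bs IH] [|l ls] //= [Ll /IH L].
exists l, (cluster_word A), (block_join bs ls), false.
by rewrite ltnn; split=> //; split.
Qed.

Lemma block_lang_join bs w : block_lang bs false w ->
  exists2 ls, block_words bs ls & w = block_join bs ls.
Proof.
elim: bs w => [|[[T A] v] bs IH] w /=; first by case=> -> _; exists [::].
case=> x [y [z [st' [[-> Lx sy] Lz]]]].
case: st' Lz => Lz; rewrite ?orbT // orbF => /esym/negbT; rewrite -leqNgt => le.
have -> : y = cluster_word A.
  by apply/eqP; rewrite -(geq_leqif (size_subseq_leqif sy)).
by have [ls ok ->] := IH _ Lz; exists (x :: ls).
Qed.

Lemma well_formed_gap_word s T A v bs (z : bword) : well_formed s ((T, A, v) :: bs) ->
  let h := gap_zigzag (nilp bs) (cluster_word A) in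
  zword h = take (zsize h).-1 (behead (cluster_word A ++ z)).
Proof.
move=> G; inversion G as [s0 T0 e A0 v0 C vs AE|s0 T0 e A0 v0 g s' bs0 C vs AE G']; subst.
  case: AE => [->|[g ->]] /=; first by rewrite take0.
  by rewrite take_size_cat.
have -> : nilp bs = false by case: (bs) G' => // H; inversion H.
by rewrite AE gap_zigzag_inner /= -cats1 -catA take_size_cat.
Qed.

Lemma delta_take h t n : n = zsize h -> (n <= size t)%N ->
  zword h = take n.-1 (word t) -> delta R h (take n t) = 1.
Proof.
move=> nE nt hE; rewrite /delta; suff -> : zigzag_of (take n t) = h by rewrite eqxx.
case: h nE hE => [h|] /= nE hE; last by rewrite nE take0.
rewrite zigzag_of_word; first by rewrite word_take hE.
by rewrite -size_eq0 size_takel // nE.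
Qed.

Lemma conv_delta h (g : seq nat -> R) t : (zsize h <= size t)%N ->
  zword h = take (zsize h).-1 (word t) ->
  conv (@delta R h) g t = g (drop (zsize h) t).
Proof.
move=> ht hE; rewrite (conv_unique ht) ?delta_take ?mul1r // => i it.
rewrite /delta pnatr_eq0 eqb0 negbK => /eqP E _.
by rewrite -(size_takel it) -zsize_zigzag_of E.
Qed.

(** The sum over all cuts has a single nonzero term, which is the product of the
    values at the components. *)
Lemma factor_conv_block_factors s bs ls t : well_formed s bs -> block_words bs ls ->
    word t = block_join bs ls -> t != [::] -> uniq t ->
    ~ block_lang bs true (word t) ->
  factor_conv (block_factors bs) t =
    \prod_(p <- zip ls bs) fund_at p.2.2 (Some p.1).
Proof.
elim: bs s ls t => [|[[T A] v] bs IH] s [|l ls] t G //.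
  by inversion G.
case=> Ll okls tE t0 Ut nJ; have [e [C vs zs gne read]] := well_formed_inv G.
have szt : size t = (size (word t)).+1.
  by case: (t) t0 => // x t' _; rewrite word_cons size_word_from.
rewrite [block_join _ _]/= in tE.
set g := cluster_word A in tE zs gne; set z := block_join bs ls in tE.
have Lz := block_join_lang okls.
rewrite [factor_conv _]/= (@conv_unique _ _ _ _ (size l).+1); first last.
- move=> i it ci /conv_neq0[t2 [t3 [dE d2 d3]]].
  rewrite -(size_takel it).
  have U3 : uniq t3.
    apply: subseq_uniq Ut; rewrite -[t](cat_take_drop i) dE catA.
    exact: suffix_subseq.
  have [st c3] := cut_factor_conv U3 d3.
  apply: (block_cut_size (t2 := t2) G Ll Lz tE t0 nJ _ ci _ c3).
    by rewrite -dE cat_take_drop.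
  move: d2; rewrite /delta pnatr_eq0 eqb0 negbK => /eqP <-.
  by rewrite /below zsize_zigzag_of leqnn subseq_refl.
- by rewrite szt tE ltnS size_cat leq_addr.
rewrite big_cons /= -fund_atE; congr (_ * _).
  congr fund_at; rewrite zigzag_of_word; last first.
    by case: (t) t0.
  by rewrite word_take tE /= take_size_cat.
set h := gap_zigzag _ _ in zs *.
have hle : ((size l).+1 + zsize h <= size t)%N.
  rewrite szt tE zs !size_cat addSn ltnS leq_add2l.
  by apply: leq_trans (leq_subr _ _) (leq_addr _ _).
have wd : word (drop (size l).+1 t) = behead (g ++ z).
  by rewrite word_drop tE -addn1 addnC -drop_drop drop_size_cat // drop1.
rewrite conv_delta ?wd; first last.
- exact: well_formed_gap_word G.
- by rewrite size_drop; lia.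
rewrite drop_drop; case: (eqVneq bs [::]) => [bsE|bs0].
  have lsE : ls = [::] by move: okls; rewrite bsE; case: (ls).
  rewrite bsE lsE big_nil /= /counit drop_oversize ?eqxx //.
  by rewrite zs szt tE /z bsE lsE /= cats0 size_cat subn0 addnS addnC.
have [g0 [s' G']] := gne bs0.
have nbs : nilp bs = false by case: (bs) bs0.
have ijE : (zsize h + (size l).+1 = size (l ++ g))%N.
  rewrite zs nbs subn1 size_cat addnS -addSn prednK 1?addnC //.
  by rewrite lt0n size_eq0.
have w3 : word (drop (zsize h + (size l).+1) t) = z.
  by rewrite word_drop tE ijE catA drop_size_cat.
rewrite ijE in w3 *.
apply: (IH s') => //.
- rewrite -size_eq0 size_drop subn_eq0 -ltnNge szt tE ltnS catA.
  by rewrite [X in (_ <= X)%N]size_cat leq_addr.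
- exact: drop_uniq.
rewrite w3 => Lz'; apply: nJ; rewrite tE; exists l, g, z, true.
by rewrite orbT; split=> //; split.
Qed.

(** The initial gap has no section on its left, so that only its last letter is a
    junction. *)
Definition head_zigzag (g : bword) : zigzag :=
  if g is b :: g' then Some (belast b g') else None.

Definition template_factors (A : seq cluster) bs : seq (factor R) :=
  inr (head_zigzag (cluster_word A)) :: block_factors bs.

Definition template_lang (A : seq cluster) bs (st : bool) (w : bword) : Prop :=
  exists y z st', [/\ w = y ++ z, subseq y (cluster_word A),
    block_lang bs st' z & st = (size y < size (cluster_word A))%N || st'].

Definition well_formed_head (s : bool) (g : bword) : Prop :=
  g = [::] \/ exists g', g = rcons g' (~~ s).

Lemma head_zigzagP s g : well_formed_head s g ->
  zsize (head_zigzag g) = size g /\ zword (head_zigzag g) = take (size g).-1 g.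
Proof.
case=> [->|[g' ->]] //; rewrite size_rcons -cats1 take_size_cat //.
by case: g' => [|b g'] //; rewrite cats1 rcons_cons [head_zigzag _]/= belast_rcons.
Qed.

Lemma template_word s A bs st t : well_formed s bs -> well_formed_head s (cluster_word A) ->
  cut (template_factors A bs) st t ->
  exists st', template_lang A bs st' (word t) /\ (st -> st').
Proof.
set g := cluster_word A => G gh; have [zsE zwE] := head_zigzagP gh.
case=> t1 [t2 [st2 [-> /andP[le1 sw1] c2 ->]]]; rewrite zsE in le1; rewrite zwE in sw1.
rewrite /= zsE; case: t1 le1 sw1 => [|a t1] le1 sw1.
  have [st' [L imp]] := block_word G c2.
  exists ((0 < size g)%N || st'); split; last by case/orP => [->|/imp ->]; rewrite ?orbT.
  by exists [::], (word t2), st'; rewrite sub0seq.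
have [jj [w [st' [J E L imp]]]] := block_word_from (last a t1) G c2.
case: gh => [g0|[g' gE]]; first by rewrite g0 in le1.
have gT : take (size g).-1 g = g' by rewrite gE size_rcons -cats1 take_size_cat.
rewrite gT in sw1.
have sy : subseq (word (a :: t1) ++ jj) g.
  by rewrite gE -cats1; case: J => ->; apply: cat_subseq; rewrite ?sub0seq.
exists ((size (word (a :: t1) ++ jj) < size g)%N || st'); split.
  exists (word (a :: t1) ++ jj), w, st'; split=> //.
  by rewrite cat_cons !word_cons word_from_cat E catA.
case/orP => [lt|/imp ->]; last by rewrite orbT.
apply/orP; left; apply: leq_ltn_trans lt.
rewrite size_cat word_cons size_word_from /= -[X in (_ <= X)%N]addn1 leq_add2l.
by case: J => ->.
Qed.

Lemma factor_conv_template s A bs ls t : well_formed s bs ->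
    well_formed_head s (cluster_word A) -> block_words bs ls ->
    word t = cluster_word A ++ block_join bs ls -> bs != [::] ->
    t != [::] -> uniq t ->
    ~ template_lang A bs true (word t) ->
  factor_conv (template_factors A bs) t =
    \prod_(p <- zip ls bs) fund_at p.2.2 (Some p.1).
Proof.
set g := cluster_word A => G gh okls tE bs0 t0 Ut nJ.
have [zsE zwE] := head_zigzagP gh.
have szt : size t = (size (word t)).+1.
  by case: (t) t0 => // x t' _; rewrite word_cons size_word_from.
rewrite [factor_conv _]/= -/g conv_delta zsE; first last.
- rewrite zwE tE take_cat; case: ltnP => // ge.
  suff g0 : g = [::] by rewrite g0 /= take0.
  by apply/eqP; rewrite -size_eq0; case: (size g) ge => //= n; rewrite ltnn.
- rewrite szt tE size_cat; apply: leqW; apply: leq_addr.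
have w2 : word (drop (size g) t) = block_join bs ls.
  by rewrite word_drop tE drop_size_cat.
apply: (factor_conv_block_factors G) => //.
- rewrite -size_eq0 size_drop subn_eq0 -ltnNge szt tE ltnS.
  by rewrite size_cat leq_addr.
- exact: drop_uniq.
rewrite w2 => L; apply: nJ; rewrite tE.
by exists g, (block_join bs ls), true; rewrite orbT.
Qed.

End BlockValues.

(** * Sections as maximal runs *)

Lemma size_window (T : Type) (x : seq T) a b : (b <= size x)%N ->
  size (window x (a, b)) = (b - a)%N.
Proof. by move=> bx; rewrite /window size_drop /= size_takel. Qed.

Lemma cluster_at_window t a b i : (a + i < b)%N ->
  cluster_at (window t (a, b)) i = cluster_at t (a + i).
Proof. by move=> ib; rewrite /cluster_at /window nth_drop nth_take. Qed.

Lemma separating_window t a b i : (b <= size t)%N -> (a + i < b)%N ->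
  separating (window t (a, b)) i = [&& (0 < i)%N, (a + i.+1 < b)%N &
    separating t (a + i)].
Proof.
move=> bt ib; rewrite /separating size_window //.
case: i ib => [|i] // ib.
rewrite -[i.+1.-1]/i ltn0Sn !andTb (_ : (a + i.+1).-1 = (a + i)%N); last by lia.
have -> : (0 < a + i.+1)%N by lia.
have [lt|ge] := ltnP (a + i.+2) b; last first.
  by have -> : (i.+2 < b - a)%N = false by lia.
have -> : (i.+2 < b - a)%N by lia.
have -> : ((a + i.+1).+1 < size t)%N by lia.
by rewrite !cluster_at_window -?addnS //; lia.
Qed.

(** In terms of positions in [t], a section is a maximal interval without
    nonseparating clusters.  Maximality among finite templates and maximality of
    the interval agree because a separating cluster has infinite neighbours,
    so that a maximal interval starts and ends with infinite clusters. *)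
Definition maxrun (t : seq cluster) (p : nat * nat) : Prop :=
  [/\ (p.1 < p.2)%N, (p.2 <= size t)%N,
      forall i, (p.1 <= i < p.2)%N -> ~~ nonseparating t i,
      p.1 = 0%N \/ nonseparating t p.1.-1
    & p.2 = size t \/ nonseparating t p.2].

Lemma finite_template_core t a b : (b <= size t)%N ->
  finite_template (window t (a, b)) ->
  forall i, (a <= i < b)%N -> ~~ nonseparating t i.
Proof.
move=> bt /andP[_ /allP H] i /andP[ai ib].
have ij : i = (a + (i - a))%N by lia.
have Hi : ~~ nonseparating (window t (a, b)) (i - a).
  by apply: H; rewrite mem_iota size_window //; lia.
have ib' : (a + (i - a) < b)%N by lia.
move: Hi; rewrite /nonseparating size_window // cluster_at_window //.
rewrite separating_window // -ij (leq_trans ib bt).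
have -> : (i - a < b - a)%N by lia.
by case: finite_cluster => //=; rewrite !negbK => /and3P[].
Qed.

Section MaximalRuns.
Variable t : seq cluster.
Lemma infinite_core i : infinite_cluster (cluster_at t i) -> ~~ nonseparating t i.
Proof. by move=> inf; rewrite /nonseparating /finite_cluster inf andbF. Qed.

Lemma core_finite i : (i < size t)%N -> ~~ nonseparating t i ->
  ~~ infinite_cluster (cluster_at t i) -> separating t i.
Proof.
by rewrite /nonseparating /finite_cluster => -> nn inf; move: nn; rewrite inf /= negbK.
Qed.

Lemma maxrun_first p : maxrun t p -> infinite_cluster (cluster_at t p.1).
Proof.
case=> lt le H B _; apply: contraT => nf.
have /and5P[p0 _ _ inf _] : separating t p.1.
  by apply: core_finite => //; [exact: leq_trans lt le | apply: H; rewrite leqnn].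
case: B => [p1|]; first by rewrite p1 in p0.
by rewrite (negbTE (infinite_core inf)).
Qed.

Lemma maxrun_last p : maxrun t p -> infinite_cluster (cluster_at t p.2.-1).
Proof.
case: p => a b [/= lt le H _ B]; apply: contraT => nf.
have b1 : b.-1.+1 = b by case: b lt {le H B nf}.
have /and5P[p0 bt _ _ inf] : separating t b.-1.
  by apply: core_finite => //; [rewrite b1 | apply: H; lia].
rewrite b1 in bt inf; case: B => [p1|]; first by rewrite p1 ltnn in bt.
by rewrite (negbTE (infinite_core inf)).
Qed.

Lemma maxrun_exists i : (i < size t)%N -> ~~ nonseparating t i ->
  exists p, [/\ maxrun t p, (p.1 <= i)%N & (i < p.2)%N].
Proof.
move=> it ci.
pose P a := (a <= i)%N && all (fun j => ~~ nonseparating t j) (iota a (i - a)).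
have exP : exists a, P a by exists i; rewrite /P leqnn subnn.
case: (ex_minnP exP) => a /andP[ai /allP Ha] mina.
pose Q b := [&& (i < b)%N, (b <= size t)%N & all (fun j => ~~ nonseparating t j) (iota i (b - i))].
have exQ : exists b, Q b by exists i.+1; rewrite /Q ltnSn it subSnn /= ci.
have ubQ b : Q b -> (b <= size t)%N by case/and3P.
case: (ex_maxnP exQ ubQ) => b /and3P[ib bt /allP Hb] maxb.
exists (a, b); split=> //; split=> //=; first by lia.
- move=> j /andP[aj jb]; have [ij|ji] := leqP i j.
    by apply: Hb; rewrite mem_iota; lia.
  by apply: Ha; rewrite mem_iota; lia.
- case: (eqVneq a 0%N) => [->|a0]; [by left | right; apply: contraT => na].
  have := mina a.-1; rewrite /P.
  have -> : (i - a.-1 = (i - a).+1)%N by lia.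
  rewrite /= na /= prednK ?lt0n // (introT allP Ha) andbT => /(_ _).
  by move=> X; have := X (ltac:(lia)); lia.
case: (eqVneq b (size t)) => [->|bne]; [by left | right; apply: contraT => nb].
suff /maxb : Q b.+1 by rewrite ltnn.
apply/and3P; split; [lia | lia | apply/allP => j; rewrite mem_iota => jb].
have [->//|jne] := eqVneq j b; apply: Hb; rewrite mem_iota; lia.
Qed.

Lemma maxrun_sub p a b : maxrun t p -> (a < b <= size t)%N ->
  (forall i, (a <= i < b)%N -> ~~ nonseparating t i) ->
  (exists2 i, (p.1 <= i < p.2)%N & (a <= i < b)%N) -> (p.1 <= a)%N /\ (b <= p.2)%N.
Proof.
case=> lt le H A B /andP[ab bt] Hab [i ip iab]; split.
  rewrite leqNgt; apply/negP => ap; case: A => [A|]; first by rewrite A in ap.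
  by apply/negP/Hab; lia.
rewrite leqNgt; apply/negP => pb; case: B => [B|]; first by lia.
by apply/negP/Hab; lia.
Qed.

Lemma maxrun_disjoint p q : maxrun t p -> maxrun t q -> p != q ->
  (p.2 <= q.1)%N || (q.2 <= p.1)%N.
Proof.
move=> Mp Mq; apply: contraNT; rewrite negb_or -!ltnNge => /andP[lt1 lt2].
have [p12 pt Hp _ _] := Mp; have [q12 qt Hq _ _] := Mq.
have [||a1 b1] := @maxrun_sub p q.1 q.2 Mp _ Hq; first by rewrite q12.
  by exists (maxn p.1 q.1); lia.
have [||a2 b2] := @maxrun_sub q p.1 p.2 Mq _ Hp; first by rewrite p12.
  by exists (maxn p.1 q.1); lia.
by rewrite [p]surjective_pairing [q]surjective_pairing; apply/eqP; congr pair; lia.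
Qed.

Lemma mem_windows p : (p \in windows t) = (p.1 < p.2 <= size t)%N.
Proof.
case: p => a b; rewrite mem_filter -[(a, b).1]/a -[(a, b).2]/b.
case: ltnP => [ab|//]; rewrite !andTb.
apply/allpairsP/idP => [[[x y] [_ yP [_ ->]]]|bt].
  by move: yP; rewrite mem_iota.
by exists (a, b); rewrite !mem_iota; split=> //; apply: leq_trans bt.
Qed.

Lemma windows_sorted : sorted lexlt (windows t).
Proof.
apply: (sorted_filter lexlt_trans); rewrite (sorted_pairwise lexlt_trans).
have: pairwise ltn (iota 0 (size t).+1).
  by rewrite -(sorted_pairwise ltn_trans) iota_ltn_sorted.
have: pairwise ltn (iota 0 (size t)).
  by rewrite -(sorted_pairwise ltn_trans) iota_ltn_sorted.
move: (iota 0 (size t).+1) (iota 0 (size t)) => v.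
elim=> //= x u IH /andP[/allP xu pu] pv.
rewrite pairwise_cat IH // andbT pairwise_map; apply/andP; split.
  apply/allrelP => _ _ /mapP[y _ ->] /allpairsP[[x' y'] [/= /xu xx _ ->]].
  by apply/orP; left; apply: xx.
apply: sub_pairwise pv => y z yz; apply/orP; right.
by rewrite /= eqxx; apply: yz.
Qed.

Hypothesis tt : template t.

Lemma cluster_mult i : (i < size t)%N -> (cluster_at t i).2 != Some 0%N.
Proof. by case/and3P: tt => /allP H _ _ it; apply: H; apply: mem_nth. Qed.

Lemma cluster_sign i : (i.+1 < size t)%N ->
  csign (cluster_at t i.+1) = ~~ csign (cluster_at t i).
Proof.
case/and3P: tt => _ /(sortedP (true, None)) H _ it; have := H i it.
by rewrite /cluster_at; do 2!case: csign.
Qed.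

Lemma maxrun_template p : maxrun t p -> finite_template (window t p).
Proof.
case: p => a b M; have [/= lt le H A B] := M.
have inf := maxrun_first M; have infl := maxrun_last M; rewrite /= in inf infl.
apply/andP; split.
  case/and3P: tt => /allP Hm Hs _; apply/and3P; split.
  - by apply/allP => c /mem_drop /mem_take /Hm.
  - by rewrite /window drop_sorted // take_sorted.
  apply/(has_nthP (true, None)); exists 0%N; first by rewrite size_window //; lia.
  by rewrite -/(cluster_at _ 0) cluster_at_window addn0.
apply/allP => i; rewrite mem_iota size_window // => /andP[_ ib].
have ib' : (a + i < b)%N by lia.
rewrite /nonseparating size_window // ib cluster_at_window // separating_window //.
rewrite /finite_cluster /=; case: (boolP (infinite_cluster _)) => //= nf.
have sep : separating t (a + i).
  by apply: core_finite => //; [exact: leq_trans ib' le | apply: H; lia].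
rewrite negbK sep andbT; apply/andP; split.
  by case: i nf {ib ib' sep} => //; rewrite addn0 inf.
rewrite addnS ltn_neqAle ib' andbT; apply: contraNneq nf => E.
by move: infl; rewrite -E.
Qed.

Lemma mem_sections p : reflect (maxrun t p) (p \in sections t).
Proof.
case: p => a b; rewrite mem_filter mem_windows /=; apply: (iffP andP).
  case=> /andP[ft /allP mx] abt; have /andP[ab bt] := abt.
  have Hab := finite_template_core bt ft.
  have [q [M qa aq]] := maxrun_exists (leq_trans ab bt) (Hab a ltac:(lia)).
  have [] := @maxrun_sub q a b M abt Hab; first by exists a; lia.
  move=> q1 q2; have [lt le _ _ _] := M.
  have := mx q; rewrite mem_windows lt le maxrun_template // q1 q2 => /(_ isT) /eqP qE.
  by rewrite -qE.
move=> M; have [/= lt le H A B] := M; rewrite lt le; split=> //.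
rewrite /is_section maxrun_template //=; apply/allP => -[a' b'].
rewrite mem_windows => /= abt; apply/implyP => /and3P[ft aa bb].
have /andP[ab' bt'] := abt.
have [] := @maxrun_sub _ a' b' M abt (finite_template_core bt' ft).
  by exists a; rewrite /=; lia.
by move=> /= a1 b1; apply/eqP; congr pair; lia.
Qed.

(** The list of the maximal runs of [t] from position [pos] on, with nothing but
    nonseparating clusters between them: this is the form in which the sections
    are used in inductions. *)
Fixpoint chain (pos : nat) (secs : seq (nat * nat)) : Prop :=
  if secs is p :: secs' then
    [/\ (pos <= p.1)%N, forall i, (pos <= i < p.1)%N -> nonseparating t i,
        maxrun t p & chain p.2 secs']
  else forall i, (pos <= i < size t)%N -> nonseparating t i.

Lemma chain_sections : chain 0 (sections t).
Proof.
(* The starting position must not cut a run, hence the disjunction. *)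
suff H secs pos : sorted lexlt secs ->
    (forall p : nat * nat, p \in secs <-> maxrun t p /\ (pos <= p.1)%N) ->
    (pos = 0%N \/ nonseparating t pos \/ pos = size t) -> chain pos secs.
  apply: H; [|move=> p|by left].
    exact: (sorted_filter lexlt_trans _ windows_sorted).
  by split=> [/mem_sections|[/mem_sections]].
have start pos' i q : pos' = 0%N \/ nonseparating t pos' \/ pos' = size t ->
    maxrun t q -> (pos' <= i)%N -> (q.1 <= i < q.2)%N -> (pos' <= q.1)%N.
  move=> Hp [_ le H _ _] pi qi; rewrite leqNgt; apply/negP => qp.
  case: Hp => [p0|[np|ps]]; [lia | | lia].
  by have := H pos'; rewrite np => Hn; have /Hn : (q.1 <= pos' < q.2)%N by lia.
elim: secs pos => [|p secs IH] pos so Hm Hpos /=.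
  move=> i /andP[pi it]; apply: contraT => ci.
  have [q [M qi iq]] := maxrun_exists it ci.
  suff : q \in [::] by [].
  by apply/Hm; split=> //; apply: start M _ _; [exact: Hpos | exact: pi | lia].
have [M pp] : maxrun t p /\ (pos <= p.1)%N by apply/Hm; rewrite mem_head.
have [lt le H A B] := M.
have lexp (q : nat * nat) : q \in secs -> lexlt p q.
  by move: so; rewrite /= path_sortedE; [case/andP => /allP H' _ /H' | exact: lexlt_trans].
split=> //.
- move=> i /andP[posi ip]; apply: contraT => ci.
  have it : (i < size t)%N by lia.
  have [q [Mq qi iq]] := maxrun_exists it ci.
  have : q \in p :: secs.
    by apply/Hm; split=> //; apply: start Mq _ _; [exact: Hpos | exact: posi | lia].
  rewrite inE => /orP[/eqP qp|/lexp]; first by move: qi; rewrite qp; lia.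
  by rewrite /lexlt; lia.
apply: IH.
- exact: path_sorted so.
- move=> q; split.
    move=> qs; have [|Mq _] := (Hm q).1; first by rewrite inE qs orbT.
    split=> //; have := lexp _ qs.
    case: (eqVneq p q) => [->|pq]; first by rewrite lexlt_irr.
    have [lq _ _ _ _] := Mq.
    case/orP: (maxrun_disjoint M Mq pq) => //; rewrite /lexlt; lia.
  case=> Mq pq; have : q \in p :: secs by apply/Hm; split=> //; lia.
  by rewrite inE => /orP[/eqP qp|//]; move: pq; rewrite qp; lia.
by right; case: B => [->|]; [right | left].
Qed.

End MaximalRuns.

(** * Proper subwords of a gap *)

Section DecreaseLang.

Lemma cluster_word_cons c A :
  cluster_word (c :: A) = nseq (odflt 0%N c.2) (csign c) ++ cluster_word A.
Proof. by []. Qed.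

(** A proper subword leaves out a letter, hence it fits after decreasing the
    multiplicity of the cluster of that letter. *)
Lemma lang_decrease A y : all finite_cluster A ->
  all (fun c : cluster => c.2 != Some 0%N) A ->
  subseq y (cluster_word A) -> (size y < size (cluster_word A))%N ->
  exists2 i, (i < size A)%N & lang (decrease A i) y.
Proof.
elim: A y => [|[b [k|]] A IH] y //= fA /andP[k0 nA].
rewrite cluster_word_cons => /subseq_cat[y1 [y2 [-> /subseq_nseq[E le1] s2]]].
rewrite /= in E le1; rewrite !size_cat size_nseq /= => lt.
have [lt1|ge1] := ltnP (size y1) k.
  exists 0%N => //; rewrite /decrease /= ?drop0 ?take0.
  have L2 : lang A y2 by apply/lang_finite.
  case: k k0 lt1 {le1 lt} => [|[|k]] // _ lt1.
    by move: lt1; rewrite ltnS leqn0 size_eq0 => /eqP ->.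
  by exists (size y1), y2; split=> //; rewrite -E.
have [|i iA Li] := IH y2 fA nA s2.
  by rewrite -(ltn_add2l k); apply: leq_ltn_trans lt; rewrite leq_add2r.
exists i.+1 => //; have -> : decrease ((b, Some k) :: A) i.+1 = (b, Some k) :: decrease A i.
  by rewrite /decrease /=; case: (cluster_at A i).
by exists (size y1), y2; split=> //; rewrite -E.
Qed.

Lemma decrease_cat pre A post i : (i < size A)%N ->
  decrease (pre ++ A ++ post) (size pre + i) = pre ++ decrease A i ++ post.
Proof.
move=> iA; rewrite /decrease.
have -> : cluster_at (pre ++ A ++ post) (size pre + i) = cluster_at A i.
  by rewrite /cluster_at nth_cat ltnNge leq_addr /= addKn nth_cat iA.
have -> : take (size pre + i) (pre ++ A ++ post) = pre ++ take i A.
  by rewrite takeD take_size_cat // drop_size_cat // takel_cat // ltnW.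
have -> : drop (size pre + i).+1 (pre ++ A ++ post) = drop i.+1 A ++ post.
  rewrite -addnS addnC -drop_drop drop_size_cat // drop_cat.
  case: ltnP => // ge; rewrite (drop_oversize ge) (_ : (i.+1 - size A)%N = 0%N) ?drop0 //.
  by apply/eqP; rewrite subn_eq0.
by case: (cluster_at A i) => b k; rewrite -!catA.
Qed.

Lemma drop_window (T : Type) (x : seq T) a b : (a <= b)%N ->
  drop a x = window x (a, b) ++ drop b x.
Proof.
move=> ab; rewrite /window /= -{1}(cat_take_drop b x) drop_cat.
case: ltnP => // ge; rewrite (drop_oversize ge) cat0s.
have [bx|xb] := leqP b (size x); last by rewrite !(drop_oversize (ltnW xb)).
by rewrite (_ : a - _ = 0)%N ?drop0 // size_takel //; apply/eqP; rewrite subn_eq0.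
Qed.

Lemma all_gap_finite t a b : (b <= size t)%N ->
  (forall i, (a <= i < b)%N -> nonseparating t i) ->
  all finite_cluster (window t (a, b)).
Proof.
move=> bt H; apply/(all_nthP (true, None)) => i; rewrite size_window // => ib.
rewrite -/(cluster_at _ i) cluster_at_window; last by lia.
by have /and3P[] := H (a + i)%N ltac:(lia).
Qed.

Lemma Jset_gap t a b u y z : (a <= b <= size t)%N ->
  (forall i, (a <= i < b)%N -> nonseparating t i) ->
  all (fun c : cluster => c.2 != Some 0%N) t ->
  lang (take a t) u -> subseq y (cluster_word (window t (a, b))) ->
  (size y < size (cluster_word (window t (a, b))))%N -> lang (drop b t) z ->
  Jset t (Some (u ++ y ++ z)).
Proof.
case/andP => ab bt H nz Lu sy lt Lz.
have fw := all_gap_finite bt H.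
have nw : all (fun c : cluster => c.2 != Some 0%N) (window t (a, b)).
  by apply/allP => c /mem_drop /mem_take; apply: (allP nz).
have [i iw Li] := lang_decrease fw nw sy lt.
rewrite size_window // in iw.
exists (a + i)%N; first by apply: H; lia.
have -> : decrease t (a + i) =
    take a t ++ decrease (window t (a, b)) i ++ drop b t.
  have tE : t = take a t ++ window t (a, b) ++ drop b t.
    by rewrite -drop_window // cat_take_drop.
  have := @decrease_cat (take a t) (window t (a, b)) (drop b t) i.
  rewrite size_window // -tE size_takel => [->|] //.
  exact: leq_trans ab bt.
apply/ZsetE; do 2!apply: lang_catI => //.
Qed.

Lemma cluster_word_head c A : c.2 != None -> c.2 != Some 0%N ->
  exists g, cluster_word (c :: A) = csign c :: g.
Proof.
case: c => b [[|k]|] // _ _; rewrite cluster_word_cons /=.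
by exists (nseq k b ++ cluster_word A).
Qed.

Lemma cluster_word_cat A B :
  cluster_word (A ++ B) = cluster_word A ++ cluster_word B.
Proof. by rewrite /cluster_word map_cat flatten_cat. Qed.

Lemma cluster_word_last A c : c.2 != None -> c.2 != Some 0%N ->
  exists g, cluster_word (rcons A c) = rcons g (csign c).
Proof.
case: c => b [[|k]|] // _ _; rewrite -cats1 cluster_word_cat cluster_word_cons.
exists (cluster_word A ++ nseq k b).
by rewrite cats0 rcons_cat -[nseq _ _]/(nseq k.+1 b) -addn1 nseqD cats1.
Qed.

End DecreaseLang.

(** * The block decomposition of a template *)

Section TemplateBlocks.
Variables (R : realType) (t : seq cluster) (w : seq R).

(** The position where the gap before the sections [secs] ends. *)
Definition nextpos (secs : seq (nat * nat)) : nat :=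
  if secs is q :: _ then q.1 else size t.

Lemma chain_gap pos secs : chain t pos secs -> (pos <= size t)%N ->
  [/\ (pos <= nextpos secs)%N, (nextpos secs <= size t)%N &
    forall i, (pos <= i < nextpos secs)%N -> nonseparating t i].
Proof.
case: secs => [|p secs] /=; first by move=> H pt; split.
by case=> pp H [lt le _ _ _] _ _; split=> //; apply: ltnW; apply: leq_trans le.
Qed.

Lemma chain_next pos secs : chain t pos secs -> chain t (nextpos secs) secs.
Proof.
case: secs => [|p secs] /=; first by move=> _ i; lia.
by case=> _ _ M C; split=> // i; lia.
Qed.

Lemma take_window a b : (a <= b)%N -> take b t = take a t ++ window t (a, b).
Proof. by move=> ab; rewrite -{1}(cat_take_drop a (take b t)) take_takel. Qed.

Lemma windowS a b : (a < b <= size t)%N ->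
  window t (a, b) = cluster_at t a :: window t (a.+1, b).
Proof.
case/andP => ab bt; rewrite /window /= (drop_nth (true, None)) ?size_takel //.
by rewrite nth_take.
Qed.

Lemma window_rcons a b : (a < b <= size t)%N ->
  window t (a, b) = rcons (window t (a, b.-1)) (cluster_at t b.-1).
Proof.
case: b => [|b] /andP[ab bt] //; rewrite /window /= (take_nth (true, None)) //.
by rewrite drop_rcons // size_takel // ltnW.
Qed.

Lemma window_nil a : window t (a, a) = [::].
Proof. by rewrite /window drop_oversize //= size_take_min geq_minl. Qed.

Lemma infinite_clusterE c : infinite_cluster c -> c = (csign c, None).
Proof. by case: c => b [k|]. Qed.

Lemma size_csigns T : size (csigns T) = ninf T.
Proof. by rewrite size_map size_filter. Qed.

Lemma csigns_cat A B : csigns (A ++ B) = csigns A ++ csigns B.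
Proof. by rewrite /csigns filter_cat map_cat. Qed.

Lemma csigns_take n T : csigns (take n T) = take (ninf (take n T)) (csigns T).
Proof.
by rewrite -{3}(cat_take_drop n T) csigns_cat take_size_cat // size_csigns.
Qed.

Lemma csigns_drop n T : csigns (drop n T) = drop (ninf (take n T)) (csigns T).
Proof.
by rewrite -{3}(cat_take_drop n T) csigns_cat drop_size_cat // size_csigns.
Qed.

Lemma head_last_rcons (T : eqType) (g g1 g2 : seq T) x y :
  g = x :: g1 -> g = rcons g2 y -> (1 < size g)%N -> g = x :: rcons (behead g2) y.
Proof.
move=> E1 E2; rewrite E2 size_rcons ltnS; case: g2 E2 => [|z g2] // E2 _ /=.
by move: E2; rewrite E1 => -[-> _].
Qed.

Lemma ninf_gap a b : (a <= b <= size t)%N ->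
  (forall i, (a <= i < b)%N -> nonseparating t i) ->
  ninf (take a t) = ninf (take b t).
Proof.
move=> /andP[ab bt] H; rewrite (take_window ab) /ninf count_cat.
have /allP fw := all_gap_finite bt H.
rewrite [X in (_ + X)%N](_ : _ = 0%N) ?addn0 //; apply/eqP.
by rewrite -leqn0 leqNgt -has_count; apply/hasPn => c /fw.
Qed.

Lemma ninf_take_le a b : (a <= b)%N -> (ninf (take a t) <= ninf (take b t))%N.
Proof. by move=> ab; rewrite (take_window ab) /ninf count_cat leq_addr. Qed.

Fixpoint template_blocks (secs : seq (nat * nat)) : seq (block R) :=
  if secs is p :: secs' then
    (window t p, window t (p.2, nextpos secs'), oriented_window t w p)
      :: template_blocks secs'
  else [::].

(** Starting from an arbitrary position [pos] lets the induction run along the list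
    of sections. *)
Lemma template_blocks_lang pos secs (u : bword) : chain t pos secs -> (pos <= size t)%N ->
  lang (drop pos t) u <-> exists y z st, [/\ u = y ++ z,
    subseq y (cluster_word (window t (pos, nextpos secs)))
    & block_lang (template_blocks secs) st z].
Proof.
elim: secs pos u => [|p secs IH] pos u C pt.
  have [_ _ Hg] := chain_gap C pt.
  rewrite (drop_window t pt) drop_size cats0 lang_finite ?all_gap_finite //.
  split=> [su|[y [z [st [-> sy [-> _]]]]]]; last by rewrite cats0.
  by exists u, [::], false; rewrite cats0.
have [nl nt Hg] := chain_gap C pt; case: C => pp _ M C; have [lt le _ _ _] := M.
have [nl' nt' Hg'] := chain_gap C le.
have -> : drop pos t = window t (pos, p.1) ++ window t p ++ drop p.2 t.
  rewrite (drop_window t pp) (drop_window t (ltnW lt)).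
  by case: (p) => a b.
split.
  case/lang_cat => y [x [-> Ly /lang_cat[x' [z [-> Lx /IH Lz]]]]].
  have [y' [z' [st [-> sy' Lz']]]] := Lz C le.
  exists y, (x' ++ y' ++ z'),
    ((size y' < size (cluster_word (window t (p.2, nextpos secs))))%N || st).
  split=> //; first by apply/lang_finite; rewrite ?all_gap_finite.
  by exists x', y', z', st.
case=> y [_ [st [-> sy [x [y' [z' [st' [[-> Lx sy'] Lz' _]]]]]]]].
apply: lang_catI; first by apply/lang_finite; rewrite ?all_gap_finite.
by apply: lang_catI => //; apply/(IH p.2) => //; exists y', z', st'.
Qed.

Lemma assembleE pos secs ls : size ls = size secs ->
  assemble t pos secs ls = cluster_word (window t (pos, nextpos secs)) ++
    block_join (template_blocks secs) ls.
Proof.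
elim: secs pos ls => [|p secs IH] pos [|l ls] //= sl.
  by rewrite /window /= take_size cats0.
by rewrite IH //; case: sl.
Qed.

Lemma block_wordsE secs ls : size ls = size secs ->
  (forall i, (i < size secs)%N ->
     Zset (window t (nth (0%N, 0%N) secs i)) (Some (nth [::] ls i))) <->
  block_words (template_blocks secs) ls.
Proof.
elim: secs ls => [|p secs IH] [|l ls] //= [sl]; split.
  move=> H; split; first by apply/ZsetE; apply: (H 0%N).
  by apply/IH => // i ilt; apply: (H i.+1).
by case=> /ZsetE Ll /(IH _ sl) H [|i] //= ilt; apply: H.
Qed.

Lemma prod_template_blocks secs ls :
  \prod_(p <- zip ls secs) fund_at (oriented_window t w p.2) (Some p.1) =
  \prod_(p <- zip ls (template_blocks secs)) fund_at p.2.2 (Some p.1).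
Proof.
elim: secs ls => [|p secs IH] [|l ls] /=; rewrite ?big_nil ?big_cons //=.
by rewrite IH.
Qed.

Hypothesis tt : template t.

Lemma gap_cluster i : nonseparating t i ->
  (cluster_at t i).2 != None /\ (cluster_at t i).2 != Some 0%N.
Proof.
case/and3P => it fi _; split; last exact: cluster_mult.
by move: fi; rewrite /finite_cluster /infinite_cluster.
Qed.

Lemma gap_head a b : (a < b <= size t)%N ->
  (forall i, (a <= i < b)%N -> nonseparating t i) ->
  exists g, cluster_word (window t (a, b)) = csign (cluster_at t a) :: g.
Proof.
move=> abt H; rewrite windowS //; have /andP[ab bt] := abt.
by have [n1 n2] := gap_cluster (H a ltac:(lia)); apply: cluster_word_head.
Qed.

Lemma gap_last a b : (a < b <= size t)%N ->
  (forall i, (a <= i < b)%N -> nonseparating t i) ->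
  exists g, cluster_word (window t (a, b)) = rcons g (csign (cluster_at t b.-1)).
Proof.
move=> abt H; rewrite window_rcons //; have /andP[ab bt] := abt.
by have [n1 n2] := gap_cluster (H b.-1 ltac:(lia)); apply: cluster_word_last.
Qed.

(** A gap of one letter between two infinite clusters would be separating. *)
Lemma gap_size a b : (0 < a < b)%N -> (b < size t)%N ->
  (forall i, (a <= i < b)%N -> nonseparating t i) ->
  infinite_cluster (cluster_at t a.-1) -> infinite_cluster (cluster_at t b) ->
  (1 < size (cluster_word (window t (a, b))))%N.
Proof.
case/andP => a0 ab bt H ia ib; have abt : (a < b <= size t)%N by lia.
have Ha : nonseparating t a by apply: H; rewrite leqnn.
have [n1 n2] := gap_cluster Ha.
rewrite windowS // cluster_word_cons size_cat size_nseq.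
case E : (cluster_at t a).2 n1 n2 => [[|[|k]]|] // _ _.
have [ba|ne] := eqVneq b a.+1.
  have /and3P[_ _ /negP[]] := Ha; apply/and5P; split=> //.
  - by rewrite -ba.
  - by rewrite E.
  - by rewrite -ba.
have ab2 : (a.+1 < b <= size t)%N by lia.
have [|g ->] := gap_head ab2; last by [].
by move=> i iP; apply: H; lia.
Qed.

Lemma run_shape_window a b : (a < b <= size t)%N ->
  (forall i, (a <= i < b)%N -> ~~ nonseparating t i) ->
  infinite_cluster (cluster_at t a) -> infinite_cluster (cluster_at t b.-1) ->
  run_shape (csign (cluster_at t a)) (window t (a, b)) (csign (cluster_at t b.-1)).
Proof.
have [n] := ubnP (b - a); elim: n a => // n IH a lt /andP[ab bt] H ia ib.
rewrite windowS ?ab // {2}(infinite_clusterE ia).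
have [E|ne] := eqVneq b a.+1.
  by rewrite -E window_nil E /=; apply: run1.
have a1b : (a.+1 < b)%N by lia.
have a1t := leq_trans a1b bt.
have sg := cluster_sign tt a1t.
have [i1|f1] := boolP (infinite_cluster (cluster_at t a.+1)).
  apply: run_adj; rewrite -sg; apply: IH => //; [lia | by rewrite a1b | move=> i iP; apply: H; lia].
have /and5P[_ a2t /eqP m1 _ i2] : separating t a.+1.
  by apply: core_finite => //; apply: H; lia.
have a2b : (a.+2 < b)%N.
  rewrite ltn_neqAle a1b andbT; apply: contraNneq f1 => E.
  by move: ib; rewrite -E.
rewrite windowS ?a1b //.
have -> : cluster_at t a.+1 = (~~ csign (cluster_at t a), Some 1%N).
  by rewrite -sg -m1; case: (cluster_at t a.+1).
apply: run_sep.
have -> : csign (cluster_at t a) = csign (cluster_at t a.+2).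
  by rewrite (cluster_sign tt a2t) sg negbK.
apply: IH => //; [lia | by rewrite a2b | move=> i iP; apply: H; lia].
Qed.

Lemma run_shape_maxrun p : maxrun t p ->
  run_shape (csign (cluster_at t p.1)) (window t p) (csign (cluster_at t p.2.-1)).
Proof.
move=> M; have [lt le H _ _] := M; case: p M lt le H => a b M lt le H.
apply: run_shape_window; first by rewrite -[X in (X < _)%N]/((a, b).1) lt.
- exact: H.
- exact: (maxrun_first M).
- exact: (maxrun_last M).
Qed.

Lemma well_formed_head_template secs : chain t 0 secs -> secs != [::] ->
  well_formed_head (csign (cluster_at t (nextpos secs)))
    (cluster_word (window t (0%N, nextpos secs))).
Proof.
case: secs => [|p secs] // [_ H M _] _ /=; have [lt le _ _ _] := M.
case: (posnP p.1) => [->|p0]; first by left; rewrite window_nil.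
right; have p1 : p.1.-1.+1 = p.1 by rewrite prednK.
have -> : ~~ csign (cluster_at t p.1) = csign (cluster_at t p.1.-1).
  by rewrite -[in LHS]p1 cluster_sign ?p1 ?negbK //; lia.
by apply: gap_last => //; lia.
Qed.

Lemma template_blocks_Jset pos secs u z : chain t pos secs -> (pos <= size t)%N ->
  secs != [::] -> lang (take (nextpos secs) t) u ->
  block_lang (template_blocks secs) true z -> Jset t (Some (u ++ z)).
Proof.
have nz : all (fun c : cluster => c.2 != Some 0%N) t by case/and3P: tt.
elim: secs pos u z => [|p secs IH] pos u z // C pt _ Lu.
case: C => pp _ M C; have [lt le _ _ _] := M; have [nl nt Hg] := chain_gap C le.
case=> x [y [z' [st [[-> Lx sy] Lz stE]]]].
have Lux : lang (take p.2 t) (u ++ x).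
  by rewrite (take_window (ltnW lt)); apply: lang_catI => //; case: (p) Lx.
have [lty|gey] := boolP (size y < size (cluster_word (window t (p.2, nextpos secs))))%N.
  rewrite catA; apply: Jset_gap Lux sy lty _ => //; first by rewrite nl.
  apply/(template_blocks_lang _ (chain_next C) nt). exists [::], z', st.
  by rewrite sub0seq.
have st1 : st by move: stE; rewrite (negbTE gey).
rewrite st1 in Lz; rewrite 2!catA -(catA u).
apply: (IH p.2) => //; first by case: (secs) Lz => [[]|].
rewrite (take_window nl) catA; apply: lang_catI => //.
by apply/lang_finite; rewrite ?all_gap_finite.
Qed.

Hypothesis sw : size w = ninf t.

Lemma oriented_window_signs p : (p.1 <= p.2)%N ->
  map snd (oriented_window t w p) = csigns (window t p).
Proof.
move=> le; rewrite /oriented_window /window /= map_drop map_take -/(unzip2 _).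
rewrite unzip2_zip; last by rewrite -/(csigns t) size_csigns sw.
by rewrite -/(csigns t) csigns_drop csigns_take take_takel.
Qed.

Lemma well_formed_template_blocks pos secs : chain t pos secs -> secs != [::] ->
  well_formed (csign (cluster_at t (nextpos secs))) (template_blocks secs).
Proof.
elim: secs pos => [|p secs IH] pos // [pp H M C] _ /=.
have [lt le Hp A B] := M.
have Cp := run_shape_maxrun M; have sg := oriented_window_signs (ltnW lt).
have [nl nt Hg] := chain_gap C le.
have p2 : p.2.-1.+1 = p.2 by case: (p.2) lt.
have first_sign : (p.2 < nextpos secs)%N ->
    csign (cluster_at t p.2) = ~~ csign (cluster_at t p.2.-1).
  by move=> lt2; rewrite -[in LHS]p2 cluster_sign // p2; lia.
case: (eqVneq secs [::]) => [E|ne].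
  rewrite E in nl nt Hg first_sign *; apply: (well_formed_last Cp sg).
  case: (ltnP p.2 (size t)) => [lt2|ge].
    right; rewrite -first_sign //; apply: gap_head => //; by rewrite lt2 /=.
  by left; have -> : p.2 = size t by [lia]; rewrite window_nil.
have Mq : exists q, [/\ maxrun t q, nextpos secs = q.1 & p.2 <= q.1]%N.
  by case: secs C ne {IH nl nt Hg first_sign} => // q secs [pq _ Mq _] _; exists q.
have [q [{}Mq qE pq]] := Mq; have [ltq leq_ Hq Aq Bq] := Mq.
have pq' : (p.2 < q.1)%N.
  rewrite ltn_neqAle pq andbT; apply/eqP => E.
  case: B => [B|]; first by lia.
  by apply/negP/Hq; lia.
have q1 : q.1.-1.+1 = q.1 by case: (q.1) pq'.
rewrite qE in nt Hg first_sign *.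
have [|g1 E1] := @gap_head p.2 q.1 _ Hg; first by rewrite pq'.
have [|g2 E2] := @gap_last p.2 q.1 _ Hg; first by rewrite pq'.
have szg : (1 < size (cluster_word (window t (p.2, q.1))))%N.
  apply: gap_size => //; [lia | lia | exact: maxrun_last | exact: maxrun_first].
rewrite first_sign // in E1.
have sq : csign (cluster_at t q.1.-1) = ~~ csign (cluster_at t q.1).
  by rewrite -[in RHS]q1 cluster_sign ?q1 ?negbK //; lia.
rewrite sq in E2; have E := head_last_rcons E1 E2 szg.
apply: (well_formed_cons Cp sg E).
by rewrite -qE; apply: IH C ne.
Qed.

Lemma template_blocks_weights pos secs : chain t pos secs -> (pos <= size t)%N ->
  flatten [seq b.2 | b <- template_blocks secs] = drop (ninf (take pos t)) (oriented t w).
Proof.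
elim: secs pos => [|p secs IH] pos C pt; have [nl nt Hg] := chain_gap C pt.
  rewrite (@ninf_gap pos (size t)) ?pt ?leqnn // take_size drop_oversize //.
  by rewrite size_zip sw geq_minl.
case: C => pp _ M C; have [lt le _ _ _] := M.
rewrite [flatten _]/= (IH p.2) // (@ninf_gap pos p.1) ?pp //.
  by rewrite (drop_window (oriented t w) (ninf_take_le (ltnW lt))).
Qed.

End TemplateBlocks.

(** * Growth models *)

Lemma block_factors_weights (R : realType) (bs : seq (block R)) :
  flatten [seq if f is inl v then v else [::] | f <- block_factors bs] =
  flatten [seq b.2 | b <- bs].
Proof.
elim: bs => [|[[T A] v] bs IH] //.
exact (congr1 (cat v) IH).
Qed.

Section GrowthModel.
Variables (R : realType) (t : seq cluster) (w : seq R).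
Hypothesis htw : growth_model t w.

Let secs := sections t.
Let bs := template_blocks t w secs.
Let A0 := window t (0%N, nextpos t secs).

Lemma growth_template : template t.
Proof. by case: htw => /andP[]. Qed.

Lemma growth_weights : size w = ninf t.
Proof. by case: htw. Qed.

Lemma sections_neq0 : secs != [::].
Proof.
have /and3P[_ _ /(has_nthP (true, None))[i it inf]] := growth_template.
have [p [M _ _]] := maxrun_exists it (infinite_core inf).
by have /(mem_sections growth_template) : maxrun t p by []; rewrite /secs; case: (sections t).
Qed.

Lemma sections_chain : chain t 0 secs.
Proof. exact: chain_sections growth_template. Qed.

Lemma Jset_None : Jset t None.
Proof.
case: htw => /andP[tt]; rewrite /finite_template tt /= -has_predC => /hasP[i _ ns] _ _ _.
by exists i; [move: ns; rewrite /= negbK | left].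
Qed.

(** J(t) is an order ideal of the zigzag graph. *)
Lemma Jset_subseq s r : subseq s r -> Jset t (zigzag_of r) -> Jset t (zigzag_of s).
Proof.
move=> sr J; case: s sr => [|x s] sr; first exact: Jset_None.
case: r sr J => [//|y r] sr [i ns /ZsetE L]; exists i => //.
by apply/ZsetE; apply: lang_subseq L _; apply: (subseq_word sr).
Qed.

(** A proper subword of a gap is a word of the template with the multiplicity of a
    finite nonseparating cluster decreased. *)
Lemma template_langJ u : template_lang A0 bs true u -> Jset t (Some u).
Proof.
have [_ nt Hg] := chain_gap sections_chain (leq0n _).
case=> y [z [st [-> sy Lz /esym]]].
have [lty _|gey /= st1] := boolP (size y < size (cluster_word A0))%N.
  rewrite -[y ++ z]cat0s; apply: Jset_gap sy lty _ => //.
  - by case/and3P: growth_template.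
  - by rewrite take0.
  apply/(template_blocks_lang w _ (chain_next sections_chain) nt).
  by exists [::], z, st; rewrite sub0seq.
rewrite st1 in Lz.
apply: (template_blocks_Jset growth_template sections_chain _ sections_neq0 _ Lz) => //.
rewrite (@take_window t 0) // take0; apply/lang_finite => //.
exact: all_gap_finite.
Qed.

Lemma template_langZ u : Zset t (Some u) <-> exists st, template_lang A0 bs st u.
Proof.
rewrite ZsetE -{1}(drop0 t) (template_blocks_lang w _ sections_chain) //.
split=> [[y [z [st [-> sy Lz]]]]|[_ [y [z [st [-> sy Lz _]]]]]].
  by exists ((size y < size (cluster_word A0))%N || st), y, z, st.
by exists y, z, st.
Qed.

Lemma decomposition_exists u : Zset t (Some u) -> ~ Jset t (Some u) ->
  exists ls, decomposition t (Some u) ls.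
Proof.
move=> /template_langZ[[|] L] nJ; first by case: nJ; apply: template_langJ.
case: L => y [z [st [-> sy Lz /esym/negbT]]]; rewrite negb_or -leqNgt => /andP[le /negbTE st0].
rewrite st0 in Lz; have [ls ok ->] := block_lang_join Lz.
have sls : size ls = size secs.
  have szE (b : seq (block R)) l : block_words b l -> size l = size b.
    by elim: b l => [|[[T A] v] b IH] [|x l] //= [_ /IH ->].
  rewrite (szE _ _ ok) /bs; by elim: secs => //= p x ->.
exists ls; split=> //; first exact/(block_wordsE t w sls).
rewrite (assembleE t w) //; congr (Some (_ ++ _)).
by apply/eqP; rewrite -(geq_leqif (size_subseq_leqif sy)).
Qed.

Definition growth_factors : seq (factor R) := template_factors A0 bs.

Lemma growth_well_formed : well_formed (csign (cluster_at t (nextpos t secs))) bs.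
Proof.
exact (well_formed_template_blocks growth_template growth_weights
         sections_chain sections_neq0).
Qed.

Lemma growth_head :
  well_formed_head (csign (cluster_at t (nextpos t secs))) (cluster_word A0).
Proof. exact (well_formed_head_template growth_template sections_chain sections_neq0). Qed.

Lemma cut_Jset s : s != [::] -> cut growth_factors true s -> Jset t (zigzag_of s).
Proof.
move=> s0 /(template_word growth_well_formed growth_head)[st [L /(_ isT) st1]].
by rewrite zigzag_of_word //; apply: template_langJ; rewrite st1 in L.
Qed.

(** Off J(t), the value at a zigzag of Z(t) is the product over its components by
    uniqueness of the cut, and outside Z(t) there is no cut
    into pieces allowed by the factors. *)
Lemma phi_semifinE s : uniq s -> ~ Jset t (zigzag_of s) ->
  phi_semifin t w (zigzag_of s) = (factor_conv growth_factors s)%:E.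
Proof.
move=> Us nJ; have s0 : s != [::].
  by apply: contra_notN nJ => /eqP ->; exact: Jset_None.
rewrite /phi_semifin memNset //; rewrite zigzag_of_word // in nJ *.
case: ifPn => [/set_mem ZP|/negP nZ]; congr (_%:E).
  have [sl Hl [wE]] : decomposition t (Some (word s)) (components t (Some (word s))).
    by have [ls D] := decomposition_exists ZP nJ; apply: xgetPex; exists ls.
  rewrite (assembleE t w) // in wE.
  rewrite prod_template_blocks; apply/esym.
  apply: (factor_conv_template growth_well_formed growth_head) => //.
  - exact/(block_wordsE t w sl).
  - by rewrite /bs; case: secs sections_neq0.
  - by move=> /template_langJ.
apply/esym/eqP/contraT => nz; case: nZ; apply/mem_set/template_langZ.
have [st c] := cut_factor_conv Us nz.
by have [st' [L _]] := template_word growth_well_formed growth_head c; exists st'.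
Qed.

Lemma char_growth_factors s :
  char_conv growth_factors s = fund_at (oriented t w) (zigzag_of s).
Proof.
rewrite char_convE fund_atE; congr (chis _ s).
transitivity (flatten [seq b.2 | b <- bs]).
  exact: (block_factors_weights bs).
by rewrite (template_blocks_weights growth_weights sections_chain) // take0 drop0.
Qed.

End GrowthModel.

Theorem proposition5p7 (R : realType) (t : seq cluster) (w : seq R)
    (mu lambda : zigzag)
    (htw : growth_model t w)
    (hmuZ : Zset t mu) (hmuJ : ~ Jset t mu) :
  eval_qsym (phi_semifin t w)
            (fps_mul (fundamental R lambda) (fundamental R mu)) =
  (eval_qsym (phi_fin t w) (fundamental R lambda) *
   eval_qsym (phi_semifin t w) (fundamental R mu))%E.
Proof.
have [s [r [U sl rm]]] := zigzag_of_surj2 lambda mu; subst lambda mu.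
have Ur : uniq r by move: U; rewrite cat_uniq => /and3P[].
have r0 : r != [::].
  by apply: contra_notN hmuJ => /eqP ->; exact: Jset_None htw.
rewrite (eval_qsym_fundamental (phi_semifinE htw Ur hmuJ)).
rewrite (@eval_qsym_fundamental _ (phi_fin t w) (fund_at (oriented t w) (zigzag_of s))) //.
rewrite fundamental_mul // -EFinM -(char_growth_factors htw).
rewrite -factor_conv_shuffle_sum //; last by move/(cut_Jset htw r0).
have phiE q : q \in shuffle s r ->
    phi_semifin t w (zigzag_of q) = (factor_conv (growth_factors t w) q)%:E.
  move=> qP; apply: phi_semifinE => //; first by rewrite (perm_uniq (shuffle_perm qP)).
  by move/(Jset_subseq htw (shuffle_subseq qP)).
rewrite (_ : (fun m => _) =
    fun m => \sum_(n <- map zigzag_of (shuffle s r)) fundamental R n m); last first.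
  by apply/funext => m; rewrite big_map.
rewrite (@eval_qsym_sum _ _ (fun n => fine (phi_semifin t w n))).
  congr (_%:E); rewrite big_map; apply: eq_big_seq => q qP.
  by rewrite phiE.
by move=> _ /mapP[q qP ->]; rewrite phiE.
Qed.
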